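(* Let $(X,T)$ be a minimal topological dynamical system. (1) Every nonconstant locally IP-rigid observable determines a canonical nontrivial factor carrying marked local IP-rigidity data: if $f\in C(X,[0,1])$ is nonconstant and $f\in\mathcal L(U,\mathbf p)$ for some nonempty open $U\subseteq X$ and some sequence $\mathbf p=(p_i)\subseteq\mathbb N$, then $\Phi_f:(X,T)\to(X_f,\sigma)$ is a nontrivial factor map, the zeroth-coordinate function $\widehat f(y)=y_0$ on $X_f$ is nonconstant, and there is a nonempty open set $W\subseteq X_f$ with $$\operatorname{IP\text{-}lim}_{\alpha\in\mathcal F}\|\widehat f\circ\sigma^{p_\alpha}-\widehat f\|_W=0 .$$ (2) For every nonempty open $U\subseteq X$ and every sequence $\mathbf p=(p_i)\subseteq\mathbb N$, the invariant core $\mathcal C(U,\mathbf p)$ determines the maximal factor whose pullback algebra is contained in $\mathcal L(U,\mathbf p)$: there is a factor map $q^{\mathrm{core}}:(X,T)\to(Y^{\mathrm{core}},S^{\mathrm{core}})$ with $(q^{\mathrm{core}})^*C(Y^{\mathrm{core}})=\mathcal C(U,\mathbf p)$, and every factor map $q:(X,T)\to(Y,S)$ with $q^*C(Y)\subseteq\mathcal L(U,\mathbf p)$ is of the form $q=\theta\circ q^{\mathrm{core}}$ for some factor map $\theta:(Y^{\mathrm{core}},S^{\mathrm{core}})\to(Y,S)$. The factor $(Y^{\mathrm{core}},S^{\mathrm{core}})$ is uniformly rigid whenever $\mathcal C(U,\mathbf p)\ne\mathbb R\mathbf 1$. (3) $(X,T)$ is not mildly mixing if and only if $\mathcal L(U,\mathbf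 p)\neq\mathbb R\mathbf 1$ for some nonempty open $U\subseteq X$ and some sequence $\mathbf p\subseteq\mathbb N$. (4) $(X,T)$ has a nontrivial uniformly rigid factor if and only if $\mathcal C(U,\mathbf p)\neq\mathbb R\mathbf 1$ for some nonempty open $U\subseteq X$ and some sequence $\mathbf p\subseteq\mathbb N$.
   Context: $\mathbb N=\{1,2,\dots\}$. A topological dynamical system is a pair $(X,T)$ with $X$ a nonempty compact metric space and $T:X\to X$ a homeomorphism. It is minimal if every forward orbit $\{T^nx:n\ge0\}$ is dense; transitive if for all nonempty open $U,V\subseteq X$ there is $n\in\mathbb N$ with $U\cap T^{-n}V\ne\emptyset$; mildly mixing if $(X\times Y,T\times S)$ is transitive for every transitive system $(Y,S)$; uniformly rigid if there is a strictly increasing $(r_k)\subseteq\mathbb N$ with $\sup_{x\in X}d(T^{r_k}x,x)\to0$ ($d$ any compatible metric). A factor map $q:(X,T)\to(Y,S)$ is a continuous surjection with $qT=Sq$; $(Y,S)$ is then a factor. It is nontrivial if $Y$ has more than one point. $C(X)=C(X,\mathbb R)$, $q^*C(Y)=\{h\circ q:h\in C(Y)\}$, and $\mathbb R\mathbf 1$ is the algebra of real constant functions. $\mathcal F$ is the set of nonempty finite subsets of $\mathbb N$; $\eta<\alpha$ means $\max\eta<\min\alpha$. For a sequence $\mathbf p=(p_i)_{i\ge1}\subseteq\mathbb N$ (no monotonicity or injectivity assumed), $p_\alpha=\sum_{i\in\alpha}p_i$. For reals $(a_\alpha)_{\alpha\in\mathcal F}$, $\operatorname{IP\text{-}lim}_{\alpha\in\mathcal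 F}a_\alpha=a$ means: for every $\varepsilon>0$ there is $\eta\in\mathcal F$ with $|a_\alpha-a|<\varepsilon$ for all $\alpha>\eta$. $\|h\|_U=\sup_{x\in U}|h(x)|$. For a nonempty open $U\subseteq X$ and $\mathbf p=(p_i)\subseteq\mathbb N$, $$\mathcal L(U,\mathbf p)=\{f\in C(X):\ \operatorname{IP\text{-}lim}_{\alpha\in\mathcal F}\|f\circ T^{p_\alpha}-f\|_U=0\},$$ $$\mathcal C(U,\mathbf p)=\{f\in C(X):\ f\circ T^j\in\mathcal L(U,\mathbf p)\text{ for every }j\in\mathbb Z\};$$ $\mathcal C(U,\mathbf p)$, the invariant core, is the largest $T^{\pm1}$-invariant subalgebra of $\mathcal L(U,\mathbf p)$. For $f\in C(X,[0,1])$ the bilateral orbit-name factor is given by $\Phi_f(x)=(f(T^jx))_{j\in\mathbb Z}\in[0,1]^{\mathbb Z}$, $X_f=\Phi_f(X)$ (product topology), with $\sigma$ the bilateral shift $(\sigma y)_j=y_{j+1}$. *)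

(* Defs.v *)
From HB Require Import structures.
From mathcomp Require Import all_boot all_order all_algebra finmap.
From mathcomp Require Import all_classical all_reals all_analysis.

Set Implicit Arguments.
Unset Strict Implicit.
Unset Printing Implicit Defensive.

Import Order.TTheory GRing.Theory Num.Theory.
Import numFieldNormedType.Exports.

Local Open Scope classical_set_scope.
Local Open Scope ring_scope.

(* A self-bijection packaged with its inverse, so that integer iterates are
   defined without choice.  Continuity is required in [is_tds]. *)
Record selfbij (X : Type) := Selfbij {
  sb_fun :> X -> X;
  sb_inv : X -> X;
  sb_funK : cancel sb_fun sb_inv;
  sb_invK : cancel sb_inv sb_fun }.

Definition zpow (X : Type) (T : selfbij X) (j : int) : X -> X :=
  match j with
  | Posz n => iter n T
  | Negz n => iter n.+1 (sb_inv T)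
  end.

Definition compatible_metric (R : realType) (X : topologicalType)
    (d : X -> X -> R) : Prop :=
  [/\ forall x y, d x y = 0 <-> x = y,
      forall x y, d x y = d y x,
      forall x y z, d x z <= d x y + d y z
    & forall (x : X) (A : set X),
        nbhs x A <-> exists2 e : R, 0 < e & [set y | d x y < e] `<=` A].

(* Spaces are topological spaces admitting a compatible metric; none of the
   notions below depends on the choice of that metric. *)
Definition is_tds (R : realType) (X : topologicalType) (T : selfbij X) : Prop :=
  [/\ [set: X] !=set0, compact [set: X],
      (exists d : X -> X -> R, compatible_metric d),
      continuous T & continuous (sb_inv T)].

Definition minimal_sys (X : topologicalType) (T : X -> X) : Prop :=
  forall x : X, dense (range (fun n : nat => iter n T x)).

Definition transitive_sys (X : topologicalType) (T : X -> X) : Prop :=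
  forall U V : set X, open U -> U !=set0 -> open V -> V !=set0 ->
  exists2 n : nat, (0 < n)%N & U `&` (iter n T @^-1` V) !=set0.

Definition prod_map (X Y : Type) (T : X -> X) (S : Y -> Y) : X * Y -> X * Y :=
  fun z => (T z.1, S z.2).

Definition mildly_mixing (R : realType) (X : topologicalType) (T : X -> X) :
    Prop :=
  forall (Y : topologicalType) (S : selfbij Y), is_tds R S ->
  transitive_sys S -> transitive_sys (prod_map T S : (X * Y)%type -> _).

Definition uniformly_rigid (R : realType) (X : topologicalType) (T : X -> X) :
    Prop :=
  exists r : nat -> nat,
    [/\ {homo r : m n / (m < n)%N}, forall k, (0 < r k)%N
      & forall d : X -> X -> R, compatible_metric d ->
          sup (range (fun x => d (iter (r k) T x) x)) @[k --> \oo] --> 0].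

Definition factor_map (X Y : topologicalType) (T : X -> X) (S : Y -> Y)
    (q : X -> Y) : Prop :=
  [/\ continuous q, range q = [set: Y] & forall x, q (T x) = S (q x)].

Definition nontrivial (Y : Type) : Prop := exists y z : Y, y <> z.

Definition pullback (R : realType) (X Y : topologicalType) (q : X -> Y) :
    set (X -> R) :=
  [set h \o q | h in [set h : Y -> R | continuous h]].

Arguments pullback R {X Y} q.

Definition constants (R : realType) (X : Type) : set (X -> R) :=
  range (fun c : R => (fun=> c) : X -> R).

Arguments constants R X : clear implicits.

Definition nonconstant (R : realType) (X : Type) (f : X -> R) : Prop :=
  exists x y, f x <> f y.

Definition FinN : set {fset nat} :=
  [set a | a != fset0 /\ forall i, i \in a -> (0 < i)%N].

Definition fin_lt (eta alpha : {fset nat}) : Prop :=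
  forall i j, i \in eta -> j \in alpha -> (i < j)%N.

(* Sequences are indexed by i >= 1; the value at 0 is never used. *)
Definition posseq (p : nat -> nat) : Prop := forall i, (0 < i)%N -> (0 < p i)%N.

Definition psum (p : nat -> nat) (alpha : {fset nat}) : nat :=
  (\sum_(i <- alpha) p i)%N.

Definition IPlim (R : realType) (a : {fset nat} -> R) (l : R) : Prop :=
  forall e : R, 0 < e ->
  exists2 eta, FinN eta &
    forall alpha, FinN alpha -> fin_lt eta alpha -> `|a alpha - l| < e.

Definition norm_on (R : realType) (X : Type) (U : set X) (h : X -> R) : R :=
  sup [set `|h x| | x in U].

Definition IPrigid_on (R : realType) (X : Type) (T : X -> X) (U : set X)
    (p : nat -> nat) (f : X -> R) : Prop :=
  IPlim (fun alpha => norm_on U (fun x => f (iter (psum p alpha) T x) - f x)) 0.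

Definition locIP (R : realType) (X : topologicalType) (T : X -> X)
    (U : set X) (p : nat -> nat) : set (X -> R) :=
  [set f | continuous f /\ IPrigid_on T U p f].

Arguments locIP R {X} T U p.

Definition invcore (R : realType) (X : topologicalType) (T : selfbij X)
    (U : set X) (p : nat -> nat) : set (X -> R) :=
  [set f | continuous f /\ forall j : int, locIP R T U p (f \o zpow T j)].

Arguments invcore R {X} T U p.

Section OrbitName.
Context (R : realType) (X : topologicalType) (T : selfbij X) (f : X -> R).

Definition orbit_name (x : X) : {ptws int -> R} := fun j => f (zpow T j x).

(* X_f with the subspace topology of R^Z (for f valued in [0,1] this is the
   same as the subspace topology of [0,1]^Z). *)
Definition name_space : topologicalType := set_type (range orbit_name).

Definition zshift (y : {ptws int -> R}) : {ptws int -> R} := fun j => y (j + 1).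
Definition zunshift (y : {ptws int -> R}) : {ptws int -> R} :=
  fun j => y (j - 1).

Lemma zpowS j x : zpow T (j + 1) x = zpow T j (T x).
Proof.
case: j => n; first by rewrite -PoszD addn1 /= -iterSr.
case: n => [|n]; first by rewrite /= sb_funK.
rewrite (_ : (Negz n.+1 + 1)%R = Negz n); first by rewrite /zpow [RHS]iterSr sb_funK.
by rewrite !NegzE -(addn1 n.+1) PoszD opprD subrK.
Qed.

Lemma shift_orbit_name x : zshift (orbit_name x) = orbit_name (T x).
Proof. by apply/funext => j; rewrite /zshift /orbit_name zpowS. Qed.

Lemma unshift_orbit_name x : zunshift (orbit_name x) = orbit_name (sb_inv T x).
Proof.
by apply/funext => j; rewrite /zunshift /orbit_name -{2}(subrK 1 j) zpowS sb_invK.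
Qed.

Lemma shift_in (y : name_space) : zshift (val y) \in range orbit_name.
Proof.
have [x _ <-] := set_valP y; rewrite shift_orbit_name.
by apply/mem_set; exists (T x).
Qed.

Lemma unshift_in (y : name_space) : zunshift (val y) \in range orbit_name.
Proof.
have [x _ <-] := set_valP y; rewrite unshift_orbit_name.
by apply/mem_set; exists (sb_inv T x).
Qed.

Definition name_shift_fun (y : name_space) : name_space :=
  exist _ (zshift (val y)) (shift_in y).
Definition name_shift_inv (y : name_space) : name_space :=
  exist _ (zunshift (val y)) (unshift_in y).

Lemma name_shiftK : cancel name_shift_fun name_shift_inv.
Proof. by move=> y; apply/val_inj/funext => j; rewrite /= /zunshift /zshift subrK. Qed.

Lemma name_shift_invK : cancel name_shift_inv name_shift_fun.
Proof. by move=> y; apply/val_inj/funext => j; rewrite /= /zunshift /zshift addrK. Qed.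

Definition name_shift : selfbij name_space :=
  Selfbij name_shiftK name_shift_invK.

Definition name_map (x : X) : name_space :=
  exist _ (orbit_name x) (mem_set (imageT orbit_name x)).

Definition name_coord0 (y : name_space) : R := (val y : int -> R) 0.

End OrbitName.

Arguments name_coord0 {R X} T f y.

(* Main.v *)
Require Import Defs.
From HB Require Import structures.
From mathcomp Require Import all_boot all_order all_algebra finmap.
From mathcomp Require Import all_classical all_reals all_analysis.
From mathcomp Require Import lra zify.

(** The proof has three ingredients.

    Uniformity from compactness.  If countably many continuous functions
    have no common zero on a compact set, then finitely many of them are jointly
    bounded away from zero there ([compact_finite_control]).  On a
    compact space $Y$ with a separating sequence $(c_n)$ this gives the metric
    [coord_metric], and it says that any continuous function on $Y\times Y$
    vanishing on the diagonal is small once finitely many $c_n$ nearly agree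
    ([uniform_by_coords]).  So, in a factor with separating coordinates, a
    rigidity estimate for the coordinates passes to all continuous functions
    and to every compatible metric.

    The name factor and the core factor.  Factor maps of minimal systems are
    semi-open ([minimal_factor_semiopen]), so $\Phi_f(U)$ contains an open set
    $W$, and the estimate on $U$ descends to it.  For the core factor, a
    countable subfamily of the core separates the same points as the whole core
    ([countable_separating_subfamily]), and the factor is the joint image of
    that subfamily.  Functions in the core are constant on the fibres of the
    quotient map, hence are pulled back; conversely pullbacks lie in the core by
    [uniform_by_coords].  A finite number of translates of $U$ cover $X$, so
    functions in the core are rigid on all of $X$ ([invcore_rigid]), and the
    core factor is uniformly rigid.  Conversely, passing to rigidity times
    with errors $2^{-i}$ makes the rigidity sequence of a uniformly rigid factor
    into an IP-rigid one ([rigid_factor_invcore]).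

    Mild mixing.  If $X\times Y$ is not transitive for some transitive $Y$, then
    returning repeatedly in $Y$ produces a sequence $p$ and open sets with
    $T^{p_\alpha}U\cap V=\emptyset$ for all $\alpha$; a bump supported in $V$ is
    then locally rigid because it vanishes identically where it is tested.
    Conversely a nonconstant locally rigid function yields such $U$, $V$ and
    $p$, and [no_return_not_mildly_mixing] turns them into a transitive system
    whose product with $X$ is not transitive: the orbit closure of the indicator
    of a lacunary set of finite sums of $p$. *)

Set Implicit Arguments.
Unset Strict Implicit.
Unset Printing Implicit Defensive.

Import Order.TTheory GRing.Theory Num.Theory.
Import numFieldNormedType.Exports.

Local Open Scope classical_set_scope.
Local Open Scope ring_scope.

(** * Metrics from countable families of functions *)

Section CompatibleMetric.
Context (R : realType) (X : topologicalType) (d : X -> X -> R).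
Hypothesis md : compatible_metric d.

Lemma cmetric_refl x : d x x = 0.
Proof. by case: md => d0 _ _ _; apply/d0. Qed.

Lemma cmetric_sym x y : d x y = d y x.
Proof. by case: md. Qed.

Lemma cmetric_triangle x y z : d x z <= d x y + d y z.
Proof. by case: md => _ _ dD _; apply: dD. Qed.

Lemma cmetric_ge0 x y : 0 <= d x y.
Proof.
have := cmetric_triangle x y x; rewrite cmetric_refl (cmetric_sym y x); lra.
Qed.

Lemma cmetric_eq0 x y : d x y = 0 -> x = y.
Proof. by case: md => d0 _ _ _ /d0. Qed.

Lemma nbhs_cmetric_ball x e : 0 < e -> nbhs x [set y | d x y < e].
Proof. by case: md => _ _ _ nb e0; apply/nb; exists e. Qed.

Lemma nbhs_cmetricP x A :
  nbhs x A -> exists2 e, 0 < e & [set y | d x y < e] `<=` A.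
Proof. by case: md => _ _ _ nb /nb. Qed.

Lemma cmetric_continuous : continuous (fun z : X * X => d z.1 z.2).
Proof.
move=> [x y]; apply/cvgrPdist_lt => e e0 /=.
exists ([set x' | d x x' < e / 2], [set y' | d y y' < e / 2]) => /=.
  by split; apply: nbhs_cmetric_ball; rewrite divr_gt0.
move=> [x' y'] /= [dx dy].
have := cmetric_triangle x x' y; have := cmetric_triangle x' y' y.
have := cmetric_triangle x' x y'; have := cmetric_triangle x y y'.
rewrite (cmetric_sym y' y) (cmetric_sym x' x) => *; rewrite ltr_norml; lra.
Qed.

Lemma cmetric_continuousr x : continuous (d x).
Proof.
move=> y; apply: (@continuous_comp X (X * X)%type R (fun y => (x, y)) (fun z => d z.1 z.2) y).
  by apply: cvg_pair; [exact: cvg_cst|exact: cvg_id].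
exact: cmetric_continuous.
Qed.

Lemma cmetric_hausdorff : hausdorff_space X.
Proof.
move=> x y xy; apply: cmetric_eq0; apply/eqP; rewrite eq_le cmetric_ge0 andbT.
apply/ler_addgt0Pr => e e0; rewrite add0r.
have e2 : 0 < e / 2 by rewrite divr_gt0.
have [z [/= xz yz]] := xy _ _ (nbhs_cmetric_ball x e2) (nbhs_cmetric_ball y e2).
have := cmetric_triangle x z y; rewrite (cmetric_sym z y); lra.
Qed.

End CompatibleMetric.

(** The open sets on which one of $g_0,\dots,g_N$ exceeds $1/(N+1)$ increase
    with $N$ and cover $E$.  Tying the number of functions to the size of the
    bound lets a single $N$ record both. *)
Lemma compact_finite_control (R : realType) (K : topologicalType) (E : set K)
    (g : nat -> K -> R) :
  compact E -> (forall n, continuous (g n)) ->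
  (forall z, E z -> exists n, g n z != 0) ->
  exists N, forall z, E z -> exists2 n, (n <= N)%N & N.+1%:R^-1 < `|g n z|.
Proof.
move=> /compact_near_coveringP cE cg sep.
have [] := cE nat \oo (fun N z => exists2 n, (n <= N)%N & N.+1%:R^-1 < `|g n z|).
  move=> z /sep [n gn0].
  have gz : 0 < `|g n z| / 2 by rewrite divr_gt0 ?normr_gt0.
  exists ([set z' | `|g n z| / 2 < `|g n z'|],
          [set N | (n <= N)%N /\ N.+1%:R^-1 < `|g n z| / 2]) => /=.
    split.
      have : `|g n z| / 2 < `|g n z| by lra.
      apply: (@cvgr_gt _ _ (nbhs z) _ (fun z' => `|g n z'|)).
      by apply: cvg_norm; exact: cg.
    apply: filterI; first exact: nbhs_infty_ge.
    exact: near_infty_natSinv_lt (PosNum gz).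
  by move=> [z' N] /= [gz' [nN Ng]]; exists n => //; exact: lt_trans gz'.
by move=> N _ /(_ N (leqnn N)) H; exists N => z /H.
Qed.

(** The cut-off $1/(n+1)$ makes the supremum finite for unbounded functions, and
    makes all but finitely many of them irrelevant at a given scale. *)
Definition coord_metric (R : realType) (K : Type) (h : nat -> K -> R)
    (x y : K) : R :=
  sup (range (fun n => Num.min `|h n x - h n y| n.+1%:R^-1)).

Section CoordMetric.
Context (R : realType) (K : topologicalType) (h : nat -> K -> R).

Let term x y n : R := Num.min `|h n x - h n y| n.+1%:R^-1.

Lemma coord_metric_ub x y :
  has_ubound (range (fun n => Num.min `|h n x - h n y| n.+1%:R^-1)).
Proof.
exists 1 => _ [n _ <-]; rewrite ge_min; apply/orP; right.
by rewrite invf_le1 // ler1n.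
Qed.

Lemma coord_metric_ge n x y : term x y n <= coord_metric h x y.
Proof. by apply: ub_le_sup; [exact: coord_metric_ub|exists n]. Qed.

Lemma coord_metric_le x y e : (forall n, term x y n <= e) ->
  coord_metric h x y <= e.
Proof.
by move=> H; apply: ge_sup; [exists (term x y 0%N), 0%N|move=> _ [n _ <-]; exact: H].
Qed.

Lemma coord_metric_term_ge0 x y n : 0 <= term x y n.
Proof. by rewrite le_min normr_ge0 invr_ge0 ler0n. Qed.

Lemma coord_metric_compatible : compact [set: K] ->
  (forall n, continuous (h n)) ->
  (forall x y, (forall n, h n x = h n y) -> x = y) ->
  compatible_metric (coord_metric h).
Proof.
move=> cK ch sep; split.
- move=> x y; split=> [xy0|->].
    apply: sep => n; apply/eqP; rewrite -subr_eq0 -normr_eq0.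
    have := coord_metric_ge n x y; rewrite xy0 => le0.
    have /eqP : term x y n = 0 by apply/eqP; rewrite eq_le le0 coord_metric_term_ge0.
    rewrite /term minEle; case: ifP => // _.
    by rewrite invr_eq0 pnatr_eq0.
  apply/eqP; rewrite eq_le (le_trans (coord_metric_term_ge0 y y 0) (coord_metric_ge 0 y y)).
  rewrite andbT; apply: coord_metric_le => n.
  by rewrite /term subrr normr0 ge_min lexx.
- by move=> x y; rewrite /coord_metric; congr sup; apply: eq_imagel => n _; rewrite distrC.
- move=> x y z; apply: coord_metric_le => n.
  apply: le_trans (lerD (coord_metric_ge n x y) (coord_metric_ge n y z)).
  have := ler_distD (h n y) (h n x) (h n z).
  have : 0 <= n.+1%:R^-1 :> R by rewrite invr_ge0 ler0n.
  have := normr_ge0 (h n x - h n y); have := normr_ge0 (h n y - h n z).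
  rewrite /term; move: (`|_|) (`|_|) (`|_|) (_^-1) => a b c i a0 b0 i0 cab.
  rewrite ge_min; apply/orP; rewrite !minEle.
  by case: ifP; case: ifP => ? ?; first [by left; lra|by right; lra].
- move=> x A; split=> [|[e e0 sA]].
    rewrite nbhsE => -[B [oB Bx] BA].
    have [|||N HN] := @compact_finite_control R K (~` B) (fun n y => h n x - h n y).
    + by apply: (subclosed_compact _ cK) => //; exact: open_closedC.
    + by move=> n y; apply: cvgB; [exact: cvg_cst|exact: ch].
    + move=> y nBy; apply: contrapT => H; apply: nBy.
      rewrite -(sep x y) // => n; apply: contrapT => hxy; apply: H; exists n.
      by rewrite subr_eq0; apply/eqP.
    exists N.+1%:R^-1; first by rewrite invr_gt0 ltr0n.
    move=> y /= dxy; apply: BA; apply: contrapT => /HN [n nN Nn].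
    have := le_lt_trans (coord_metric_ge n x y) dxy.
    rewrite /term gt_min ltNge (ltW Nn) /= ltNge.
    by rewrite lef_pV2 ?ler_nat ?posrE ?ltr0n // ltnS nN.
  apply: (filterS sA).
  have e2 : 0 < e / 2 by rewrite divr_gt0.
  have [N _ HN] := near_infty_natSinv_lt (PosNum e2).
  have : \forall y \near x, forall n : 'I_N, `|h n x - h n y| < e / 2.
    apply: filter_forall => n; by move/cvgrPdist_lt: (ch n x) => /(_ _ e2).
  apply: filterS => y Hy.
  apply: (@le_lt_trans _ _ (e / 2)); last lra.
  apply: coord_metric_le => n; rewrite /term ge_min.
  have [nN|Nn] := ltnP n N; first by rewrite (ltW (Hy (Ordinal nN))).
  by apply/orP; right; apply: ltW; exact: HN.
Qed.

End CoordMetric.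

Lemma set_val_continuous (Z : topologicalType) (A : set Z) :
  continuous (val : set_type A -> Z).
Proof. by rewrite -set_valE; exact: (@initial_continuous (set_type A) Z set_val). Qed.

Lemma cvg_set_type (K : Type) (F : set_system K) (Z : topologicalType)
    (A : set Z) (u : K -> set_type A) (y : set_type A) : Filter F ->
  val (u k) @[k --> F] --> val y -> u @ F --> y.
Proof.
move=> FF cu B; rewrite nbhsE => -[_ [[D oD <-] Dy DB]].
rewrite set_valE in Dy DB.
apply: (@filterS _ F _ ((fun k => val (u k)) @^-1` D)).
  by move=> k Dk; exact: DB.
by apply: cu; exact: open_nbhs_nbhs.
Qed.

Lemma continuous_set_type (X Z : topologicalType) (A : set Z)
  (q : X -> set_type A) : continuous (fun x => val (q x)) -> continuous q.
Proof. by move=> cq x; apply: cvg_set_type; exact: cq. Qed.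

Lemma compact_set_type (Z : topologicalType) (A : set Z) :
  compact A -> compact [set: set_type A].
Proof.
move=> cA F PF _.
have [] := cA (fmap (val : set_type A -> Z) F) (fmap_proper_filter _ _).
  change (F (val @^-1` A)).
  by apply: (filterS _ (@filterT _ F _)) => y _; exact: set_valP.
move=> a [Aa cla]; exists (exist _ a (mem_set Aa)); split=> // B C FB.
rewrite nbhsE => -[_ [[D oD <-] Da DC]]; rewrite set_valE in Da DC.
have FvB : F (val @^-1` (val @` B)).
  by apply: (filterS _ FB) => y By; exists y.
have [z [[y By yz] Dz]] := cla _ _ FvB (open_nbhs_nbhs (conj oD Da)).
by exists y; split => //; apply: DC; rewrite /= yz.
Qed.

Lemma ptws_cvg (K I : Type) (F : set_system K) (Z : topologicalType)
    (u : K -> {ptws I -> Z}) (y : {ptws I -> Z}) : Filter F ->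
  (forall i, u k i @[k --> F] --> y i) -> u @ F --> y.
Proof.
move=> FF cu; apply/cvg_sup => i U [V [[W oW <-] Wx] VU].
apply: (@filterS _ F _ ((fun k => u k i) @^-1` W)).
  by move=> k Wk; exact: VU.
by apply: (cu i); exact: open_nbhs_nbhs.
Qed.

Lemma ptws_continuous (X : topologicalType) (I : Type) (Z : topologicalType)
  (q : X -> {ptws I -> Z}) : (forall i, continuous (fun x => q x i)) ->
  continuous q.
Proof. by move=> cq x; apply: ptws_cvg => i; exact: cq. Qed.

Lemma ptws_coord_continuous (I : eqType) (Z : topologicalType) (i : I) :
  continuous (fun y : {ptws I -> Z} => y i).
Proof. exact: (@proj_continuous I (fun=> Z) i). Qed.

(** * Rigidity estimates, integer iterates and minimal covers *)

(** The coordinates of a product of countably many lines separate points. *)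
Lemma coords_metrizable (R : realType) (I : countType) (A : set {ptws I -> R}) :
  compact A -> exists d : set_type A -> set_type A -> R, compatible_metric d.
Proof.
move=> cA.
pose h n (y : set_type A) : R :=
  if (choice.unpickle n : option I) is Some i then (val y : I -> R) i else 0.
exists (coord_metric h); apply: coord_metric_compatible.
- exact: compact_set_type.
- move=> n; rewrite /h; case: (choice.unpickle n : option I) => [i|]; last exact: cst_continuous.
  move=> y; apply: (@continuous_comp (set_type A) {ptws I -> R} R val (fun z => z i) y).
    exact: set_val_continuous.
  exact: ptws_coord_continuous.
- move=> x y xy; apply/val_inj/funext => i.
  by have := xy (choice.pickle i); rewrite /h choice.pickleK.
Qed.

(** A continuous surjection from a compact space onto a Hausdorff one is closed,
    hence a quotient map. *)
Lemma continuous_descends (X Y Z : topologicalType) (q : X -> Y) (h : Y -> Z) :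
  compact [set: X] -> hausdorff_space Y -> continuous q ->
  range q = [set: Y] -> continuous (h \o q) -> continuous h.
Proof.
move=> cX hY cq qT /continuous_closedP chq; apply/continuous_closedP => C /chq cl.
have -> : h @^-1` C = q @` ((h \o q) @^-1` C).
  apply/seteqP; split=> [y|_ [x hx <-]] //= hy.
  have [x _ qx] : range q y by rewrite qT.
  by exists x => //=; rewrite qx.
apply: compact_closed => //; apply: continuous_compact.
  exact: continuous_subspaceT.
exact: (subclosed_compact cl cX).
Qed.

Lemma iter_continuous (X : topologicalType) (T : X -> X) n :
  continuous T -> continuous (iter n T).
Proof.
move=> cT; elim: n => [|n IH] x; first exact: cvg_id.
by apply: (@continuous_comp _ _ _ (iter n T) T); [exact: IH|exact: cT].
Qed.

Lemma continuous_compact_bounded (R : realType) (X : topologicalType)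
    (f : X -> R) :
  compact [set: X] -> continuous f -> exists M, forall x, `|f x| <= M.
Proof.
move=> /compact_near_coveringP cX cf.
have [] := cX nat \oo (fun N x => `|f x| <= N%:R).
  move=> x _; exists ([set y | `|f y| < `|f x| + 1],
                      [set N | `|f x| + 1 <= N%:R]) => /=.
    split; last exact: nbhs_infty_ger.
    have : `|f x| < `|f x| + 1 by lra.
    apply: (@cvgr_lt _ _ (nbhs x) _ (fun y => `|f y|)).
    by apply: cvg_norm; exact: cf.
  by move=> [y N] /= [fy fN]; exact: (ltW (lt_le_trans fy fN)).
by move=> N _ /(_ N (leqnn N)) H; exists N%:R => x; exact: H.
Qed.

Section IPRigid.
Context (R : realType) (X : Type) (T : X -> X) (U : set X) (p : nat -> nat).
Context (f : X -> R).
Hypotheses (U0 : U !=set0) (bf : exists M, forall x, `|f x| <= M).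

(** Boundedness of $f$ makes the suprema finite, so the norm becomes a pointwise
    estimate, and only the maximum of the set below $\alpha$ matters.  Every
    later argument uses rigidity in this form. *)
Lemma IPrigidP : IPrigid_on T U p f <->
  forall e : R, 0 < e -> exists N : nat, forall alpha, FinN alpha ->
    (forall i, i \in alpha -> (N < i)%N) ->
    forall x, U x -> `|f (iter (psum p alpha) T x) - f x| <= e.
Proof.
have [M fM] := bf; have [u Uu] := U0.
have ub a : has_ubound [set `|f (iter (psum p a) T x) - f x| | x in U].
  exists (M + M) => _ [x _ <-]; apply: le_trans (ler_normB _ _) _.
  exact: lerD.
split=> [lim e e0|H e e0].
  have [eta Feta Heta] := lim e e0.
  exists (\max_(i <- eta) i)%N => a Fa etaa x Ux.
  have : fin_lt eta a.
    move=> i j ieta /etaa; apply: leq_ltn_trans; exact: leq_bigmax_seq.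
  move=> /(Heta _ Fa); rewrite subr0 => /ltW; apply: le_trans.
  by apply: le_trans (ler_norm _); apply: ub_le_sup => //; exists x.
have e2 : 0 < e / 2 by rewrite divr_gt0.
have [N HN] := H _ e2; exists [fset N.+1]%fset.
  split; first by apply/fset0Pn; exists N.+1; rewrite inE.
  by move=> i; rewrite inE => /eqP ->.
move=> a Fa Na.
have {}Na i : i \in a -> (N < i)%N.
  by move=> ia; apply: (ltn_trans (ltnSn N)); apply: Na; rewrite ?inE.
rewrite subr0 ger0_norm.
  apply: (@le_lt_trans _ _ (e / 2)); last lra.
  apply: ge_sup; first by exists `|f (iter (psum p a) T u) - f u|, u.
  by move=> _ [x Ux <-]; exact: HN.
apply: le_trans (normr_ge0 (f (iter (psum p a) T u) - f u)) _.
by apply: ub_le_sup => //; exists u.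
Qed.

End IPRigid.

Lemma psum_fsetU1 p i (a : {fset nat}) :
  i \notin a -> psum p (i |` a)%fset = (p i + psum p a)%N.
Proof. by move=> ia; rewrite /psum big_fsetU1. Qed.

Lemma psum_fsetD1 p i (a : {fset nat}) :
  i \in a -> psum p a = (p i + psum p (a `\ i)%fset)%N.
Proof. by move=> ia; rewrite /psum (big_fsetD1 i). Qed.

Section Zpow.
Context (X : topologicalType) (T : selfbij X).

Lemma zpow_pred j x : zpow T (j - 1) x = zpow T j (sb_inv T x).
Proof. by rewrite -{2}(subrK 1 j) zpowS sb_invK. Qed.

Lemma zpowD i j x : zpow T (i + j) x = zpow T i (zpow T j x).
Proof.
elim/int_ind: j x => [|n IH|n IH] x; first by rewrite addr0.
  by rewrite intS (addrC 1) addrA !zpowS IH.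
by rewrite intS (addrC 1) opprD addrA !zpow_pred IH.
Qed.

Lemma zpowK j : cancel (zpow T j) (zpow T (- j)).
Proof. by move=> x; rewrite -zpowD addNr. Qed.

Lemma zpowNK j : cancel (zpow T (- j)) (zpow T j).
Proof. by move=> x; rewrite -zpowD addrN. Qed.

End Zpow.

Lemma zpow_continuous (X : topologicalType) (T : selfbij X) j :
  continuous T -> continuous (sb_inv T) -> continuous (zpow T j).
Proof. by move=> cT cT'; case: j => n; apply: iter_continuous. Qed.

Section Minimal.
Context (X : topologicalType) (T : selfbij X).
Hypotheses (cX : compact [set: X]) (cT : continuous T) (mT : minimal_sys T).

Lemma minimal_return U : open U -> U !=set0 ->
  exists N, forall x, exists2 j, (j <= N)%N & U (iter j T x).
Proof.
move=> oU U0; move/compact_near_coveringP: cX => cX'.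
have [] := cX' nat \oo (fun N x => exists2 j, (j <= N)%N & U (iter j T x)).
  move=> x _; have [z [Uz [j _ jz]]] := mT x U0 oU; move: jz Uz => <- Uj.
  exists (iter j T @^-1` U, [set N | (j <= N)%N]) => /=.
    split; last exact: nbhs_infty_ge.
    by apply: (iter_continuous cT); exact: open_nbhs_nbhs.
  by move=> [y N] /= [Uy jN]; exists j.
by move=> N _ /(_ N (leqnn N)) H; exists N => x; exact: H.
Qed.

(** Forward translates also cover, because the return time from $T^{-N}x$ to $U$
    is at most $N$. *)
Lemma minimal_cover U : open U -> U !=set0 ->
  exists N, forall x, exists j u, [/\ (j <= N)%N, U u & x = iter j T u].
Proof.
move=> oU U0; have [N HN] := minimal_return oU U0; exists N => x.
have [j jN Uj] := HN (zpow T (- N%:Z) x).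
exists (N - j)%N, (iter j T (zpow T (- N%:Z) x)); split=> //; first exact: leq_subr.
by rewrite -iterD subnK // -[iter _ _]/(zpow T N%:Z) zpowNK.
Qed.

End Minimal.

(** The finite case of the Baire category theorem: the part of the open set
    outside one closed set is open, and if nonempty it is covered by the
    others. *)
Lemma finite_closed_cover_interior (K : topologicalType) (E : nat -> set K) N
    (B : set K) :
  (forall n, closed (E n)) -> open B -> B !=set0 ->
  (forall y, B y -> exists2 n, (n <= N)%N & E n y) ->
  exists2 n, (n <= N)%N & exists W, [/\ open W, W !=set0 & W `<=` E n].
Proof.
move=> cE; elim: N B => [|N IH] B oB B0 BE.
  exists 0%N => //; exists B; split=> // y /BE [n].
  by rewrite leqn0 => /eqP ->.
have [BN|/existsNP [y /not_implyP [By nEy]]] :=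
  pselect (forall y, B y -> E N.+1 y).
  by exists N.+1 => //; exists B.
have [|||n nN W] := IH (B `&` ~` E N.+1).
- by apply: openI => //; exact: closed_openC.
- by exists y.
- move=> z [Bz nEz]; have [n] := BE z Bz.
  by rewrite leq_eqVlt => /orP[/eqP -> //|nN Ez]; exists n.
by exists n => //; exact: leqW.
Qed.

(** * Factors given by countably many observables *)

Lemma compact_range (X Y : topologicalType) (q : X -> Y) :
  compact [set: X] -> continuous q -> compact (range q).
Proof.
by move=> cX cq; apply: continuous_compact => //; exact: continuous_subspaceT.
Qed.

Section FactorBasics.
Context (X Y : topologicalType) (T : selfbij X) (S : selfbij Y) (q : X -> Y).
Hypothesis qTS : forall x, q (T x) = S (q x).

Lemma factor_iter n x : q (iter n T x) = iter n S (q x).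
Proof. by elim: n => //= n IH; rewrite qTS IH. Qed.

Lemma factor_inv x : q (sb_inv T x) = sb_inv S (q x).
Proof. by rewrite -{2}(sb_invK T x) qTS sb_funK. Qed.

Lemma factor_zpow j x : q (zpow T j x) = zpow S j (q x).
Proof.
case: j => n /=; first exact: factor_iter.
by elim: n => [|n IH]; rewrite /= factor_inv // IH.
Qed.

End FactorBasics.

Lemma finite_uniform_bound (Q : nat -> nat -> Prop) M :
  (forall n, exists N, Q n N) -> (forall n N N', (N <= N')%N -> Q n N -> Q n N') ->
  exists N, forall n, (n <= M)%N -> Q n N.
Proof.
move=> exQ mQ; elim: M => [|M [N HN]].
  by have [N QN] := exQ 0%N; exists N => n; rewrite leqn0 => /eqP ->.
have [N' QN'] := exQ M.+1; exists (maxn N N') => n.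
rewrite leq_eqVlt => /orP[/eqP ->|/HN]; first exact: mQ (leq_maxr _ _) QN'.
exact: mQ (leq_maxl _ _).
Qed.

(** Strict growth is obtained by bounding each choice below by the previous
    one. *)
Lemma increasing_choice (P : nat -> nat -> Prop) :
  (forall k m, exists2 r, (m < r)%N & P k r) ->
  exists r : nat -> nat,
    [/\ {homo r : m n / (m < n)%N}, forall k, (0 < r k)%N & forall k, P k (r k)].
Proof.
move=> H; pose c k m := s2val (cid2 (H k m)).
have cm k m : (m < c k m)%N by rewrite /c; case: cid2.
have cP k m : P k (c k m) by rewrite /c; case: cid2.
pose r := fix r k := if k is k'.+1 then c k (r k') else c 0%N 0%N.
exists r; split.
- by apply: homo_ltn => [|n]; [exact: ltn_trans|exact: cm].
- by case=> [|k]; [exact: cm|exact: leq_ltn_trans (leq0n _) (cm _ _)].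
- by case=> [|k]; exact: cP.
Qed.

(** Terms of $p$ are at least $1$, so enough of them have a large sum. *)
Lemma exists_FinN_psum_gt p N m : posseq p ->
  exists a, [/\ FinN a, forall i, i \in a -> (N < i)%N & (m < psum p a)%N].
Proof.
move=> pp; pose a := seq_fset tt (iota N.+1 m.+1).
have aN i : i \in a -> (N < i)%N by rewrite seq_fsetE mem_iota => /andP[].
exists a; split=> //.
  split; last by move=> i /aN; exact: leq_ltn_trans.
  by apply/fset0Pn; exists N.+1; rewrite seq_fsetE mem_iota leqnn addnS ltnS leq_addr.
have sa : size a = m.+1 by rewrite size_seq_fset undup_id ?iota_uniq // size_iota.
rewrite -sa -sum1_size /psum big_seq [leqRHS]big_seq; apply: leq_sum => i /aN Ni.
by apply: pp; exact: leq_ltn_trans Ni.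
Qed.

(** The $g_n$ have no common zero on the compact set $|F|\ge e$, which misses the
    diagonal.  For $F(y,z)=h(y)-h(z)$ this is uniform continuity of $h$. *)
Lemma uniform_control (R : realType) (Y : topologicalType)
    (g : nat -> Y * Y -> R) (F : Y * Y -> R) (e : R) :
  compact [set: Y] -> (forall n, continuous (g n)) ->
  (forall y z, (forall n, g n (y, z) = 0) -> y = z) ->
  continuous F -> (forall y, F (y, y) = 0) -> 0 < e ->
  exists M, forall y z,
    (forall n, (n <= M)%N -> `|g n (y, z)| <= M.+1%:R^-1) -> `|F (y, z)| < e.
Proof.
move=> cY cg sep cF F0 e0.
have [||M HM] := @compact_finite_control R (Y * Y)%type [set w | e <= `|F w|] g _ cg.
- apply: (@subclosed_compact _ _ [set: (Y * Y)%type]) => //.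
    apply: (@preimage_closed _ _ (fun w => `|F w|) [set r | e <= r]).
      by move=> w _; apply: cvg_norm; exact: cF.
    exact: closed_ge.
  by rewrite -setXTT; exact: compact_setX.
- move=> [y z] /= Fyz; apply: contrapT => H.
  have yz : y = z.
    by apply: sep => n; apply: contrapT => /eqP yz; apply: H; exists n.
  by move: Fyz; rewrite yz F0 normr0 leNgt e0.
exists M => y z H; rewrite ltNge; apply/negP => /(HM (y, z)) [n nM].
by rewrite ltNge H.
Qed.

Lemma difference_continuous (R : realType) (Y : topologicalType) (c : Y -> R) :
  continuous c -> continuous (fun w : Y * Y => c w.1 - c w.2).
Proof.
move=> cc w; apply: cvgB.
  by apply: (@continuous_comp (Y * Y)%type Y R fst c w); [exact: cvg_fst|exact: cc].
by apply: (@continuous_comp (Y * Y)%type Y R snd c w); [exact: cvg_snd|exact: cc].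
Qed.

(** The form used for factors given by coordinates: closeness of finitely many
    coordinates controls everything continuous. *)
Lemma uniform_by_coords (R : realType) (Y : topologicalType) (c : nat -> Y -> R)
    (F : Y * Y -> R) (e : R) :
  compact [set: Y] -> (forall n, continuous (c n)) ->
  (forall y z, (forall n, c n y = c n z) -> y = z) ->
  continuous F -> (forall y, F (y, y) = 0) -> 0 < e ->
  exists M, forall y z,
    (forall n, (n <= M)%N -> `|c n y - c n z| <= M.+1%:R^-1) -> `|F (y, z)| < e.
Proof.
move=> cY cc sep cF F0 e0.
apply: (@uniform_control R Y (fun n w => c n w.1 - c n w.2) F e cY) => //.
  by move=> n; exact: difference_continuous.
by move=> y z yz; apply: sep => n; exact: subr0_eq (yz n).
Qed.

Section CoordinateFactor.
Context (R : realType) (X : topologicalType) (T : selfbij X).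
Context (h : nat -> X -> R).
Hypotheses (tdsT : is_tds R T) (ch : forall n, continuous (h n)).
Hypothesis hT : forall x y, (forall n, h n x = h n y) ->
  forall n, h n (T x) = h n (T y) /\ h n (sb_inv T x) = h n (sb_inv T y).

(** The underlying space is the joint image of the family.  The shift is defined
    through a section of the quotient map, and [hT] makes it independent of the
    section. *)
Lemma coordinate_factor : exists (Y : topologicalType) (S : selfbij Y)
    (q : X -> Y) (c : nat -> Y -> R),
  [/\ is_tds R S, factor_map T S q, forall n, continuous (c n),
      forall y z, (forall n, c n y = c n z) -> y = z
    & forall n x, h n x = c n (q x)].
Proof.
have [[x0 _] cX _ cT cT'] := tdsT.
pose q0 (x : X) : {ptws nat -> R} := fun n => h n x.
pose Y : topologicalType := set_type (range q0).
pose q (x : X) : Y := exist _ (q0 x) (mem_set (imageT q0 x)).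
have qE x y : (forall n, h n x = h n y) -> q x = q y.
  by move=> xy; apply/val_inj/funext.
have hE x y n : q x = q y -> h n x = h n y.
  by move=> /(congr1 val) /(congr1 (fun g => g n)).
have qsurj (y : Y) : {x | q x = y}.
  by apply: cid; have [x _ xy] := set_valP y; exists x; exact: val_inj.
pose s y := sval (qsurj y).
have sK y : q (s y) = y by rewrite /s; case: (qsurj y).
pose S0 y := q (T (s y)); pose S1 y := q (sb_inv T (s y)).
have S0q x : S0 (q x) = q (T x).
  by apply: qE => n; apply: (hT _ n).1 => m; apply: hE; rewrite sK.
have S1q x : S1 (q x) = q (sb_inv T x).
  by apply: qE => n; apply: (hT _ n).2 => m; apply: hE; rewrite sK.
have SK : cancel S0 S1 by move=> y; rewrite /S0 S1q sb_funK sK.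
have SK' : cancel S1 S0 by move=> y; rewrite /S1 S0q sb_invK sK.
have cq0 : continuous q0 by apply: ptws_continuous => n; exact: ch.
have cq : continuous q by apply: continuous_set_type.
have cr := compact_range cX cq0.
have [d md] := coords_metrizable cr.
have qT : range q = [set: Y].
  by apply/seteqP; split=> // y _; exists (s y).
have hY := cmetric_hausdorff md.
exists Y, (Selfbij SK SK'), q, (fun n y => (val y : nat -> R) n); split=> //.
- split; first by exists (q x0).
  + exact: compact_set_type.
  + by exists d.
  + apply: (continuous_descends cX hY cq qT).
    rewrite (_ : _ \o q = q \o T); last by apply/funext => x; exact: S0q.
    by move=> x; apply: continuous_comp; [exact: cT|exact: cq].
  + apply: (continuous_descends cX hY cq qT).
    rewrite (_ : _ \o q = q \o sb_inv T); last by apply/funext => x; exact: S1q.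
    by move=> x; apply: continuous_comp; [exact: cT'|exact: cq].
- by split=> // x; rewrite /= S0q.
- move=> n y.
  apply: (@continuous_comp Y {ptws nat -> R} R val (fun z => z n) y).
    exact: set_val_continuous.
  exact: ptws_coord_continuous.
- by move=> y z yz; apply/val_inj/funext.
Qed.

End CoordinateFactor.

Section SeparatingSequence.
Context (R : realType) (X : topologicalType) (d : X -> X -> R).
Context (C : set (X -> R)).
Hypotheses (cX : compact [set: X]) (md : compatible_metric d).
Hypotheses (C0 : C !=set0) (cC : forall f, C f -> continuous f).

Let sepset := [set z : X * X | exists2 f, C f & f z.1 <> f z.2].

(* the pairs at distance at least $1/(k+1)$ from the unseparated ones *)
Let level k := [set z : X * X |
  forall w : X * X, d z.1 w.1 + d z.2 w.2 < k.+1%:R^-1 -> sepset w].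

Let level_compact k : compact (level k).
Proof.
apply: (@subclosed_compact _ _ [set: (X * X)%type]) => //; last first.
  by rewrite -setXTT; exact: compact_setX.
move=> z clz w zw.
set e := k.+1%:R^-1 in zw *; pose r := (e - (d z.1 w.1 + d z.2 w.2)) / 2.
have r0 : 0 < r by rewrite divr_gt0 // subr_gt0.
have [|z' [z'E [/= dz1 dz2]]] := clz ([set x | d z.1 x < r] `*` [set x | d z.2 x < r]).
  by exists ([set x | d z.1 x < r], [set x | d z.2 x < r]) => //; split;
    exact: nbhs_cmetric_ball.
apply: z'E; have := cmetric_triangle md z'.1 z.1 w.1.
have := cmetric_triangle md z'.2 z.2 w.2.
rewrite (cmetric_sym md z'.1 z.1) (cmetric_sym md z'.2 z.2) -/e.
move: dz1 dz2; rewrite /r; lra.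
Qed.

Let level_cover z : sepset z -> exists k, level k z.
Proof.
move=> [f Cf fz]; pose r := `|f z.1 - f z.2| / 2.
have r0 : 0 < r by rewrite divr_gt0 // normr_gt0 subr_eq0; apply/eqP.
have near x : exists2 e, 0 < e & [set y | d x y < e] `<=` [set y | `|f x - f y| < r].
  by apply: (nbhs_cmetricP md); have /(_ x) /cvgrPdist_lt /(_ _ r0) := cC Cf.
have [e1 e10 H1] := near z.1; have [e2 e20 H2] := near z.2.
have e0 : 0 < Num.min e1 e2 by rewrite lt_min e10 e20.
have [k _ /(_ k (leqnn k)) /= ke] := near_infty_natSinv_lt (PosNum e0).
exists k => w zw; exists f => // fw.
have d1 := cmetric_ge0 md z.1 w.1; have d2 := cmetric_ge0 md z.2 w.2.
move: ke; rewrite lt_min => /andP[ke1 ke2].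
have /H1 /= h1 : d z.1 w.1 < e1.
  by apply: le_lt_trans (lt_trans zw ke1); rewrite lerDl.
have /H2 /= h2 : d z.2 w.2 < e2.
  by apply: le_lt_trans (lt_trans zw ke2); rewrite lerDr.
have := ler_distD (f w.1) (f z.1) (f z.2).
rewrite {2}fw (distrC (f w.2)); move: h1 h2; rewrite /r; lra.
Qed.

Let level_finite k : exists2 s : seq (X -> R), (forall f, f \in s -> C f) &
  forall z, level k z -> exists2 f, f \in s & f z.1 <> f z.2.
Proof.
(* ordering finite subfamilies by inclusion makes near-covering produce a
   finite subcover *)
pose F : set_system (seq (X -> R)) := fun P => exists2 s0 : seq (X -> R),
  (forall f, f \in s0 -> C f) & forall s, {subset s0 <= s} -> P s.
have FF : Filter F.
  split.
  - by exists [::].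
  - move=> P Q [s Cs Ps] [t Ct Qt]; exists (s ++ t).
      by move=> f; rewrite mem_cat => /orP[/Cs|/Ct].
    move=> u stu; split; [apply: Ps|apply: Qt] => f fs; apply: stu;
      by rewrite mem_cat fs ?orbT.
  - by move=> P Q PQ [s Cs Ps]; exists s => // u /Ps /PQ.
have /compact_near_coveringP cE := @level_compact k.
have [] := cE _ F (fun s z => exists2 f, f \in s & f z.1 <> f z.2) FF.
  move=> z Ez; have [|f Cf fz] := Ez z.
    by rewrite !(cmetric_refl md) addr0 invr_gt0 ltr0n.
  exists ([set w | f w.1 - f w.2 != 0], [set s : seq (X -> R) | f \in s]) => /=.
    split; last first.
      by exists [:: f] => [g|s]; [rewrite inE => /eqP ->|apply; rewrite inE].
    apply: (@cvgr_neq0 _ R _ (nbhs z) _ _ _ (difference_continuous (cC Cf) (x := z))).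
    by rewrite subr_eq0; apply/eqP.
  by move=> [w s] /= [fw fs]; exists f => // fw'; rewrite fw' subrr eqxx in fw.
by move=> s Cs H; exists s => // z; exact: H.
Qed.

(** The open set of separated pairs is a countable union of compact sets, each
    of which is handled by finitely many functions. *)
Lemma countable_separating_subfamily : exists h : nat -> X -> R,
  (forall n, C (h n)) /\
  forall x y, (forall n, h n x = h n y) -> forall f, C f -> f x = f y.
Proof.
have [f0 Cf0] := C0.
pose s k := s2val (cid2 (@level_finite k)).
have sC k f : f \in s k -> C f by rewrite /s; case: cid2 => ? /= + _; apply.
have sE k z : level k z -> exists2 f, f \in s k & f z.1 <> f z.2.
  by rewrite /s; case: cid2 => ? /= _; apply.
pose h n := if (choice.unpickle n : option (nat * nat)) is Some ki
            then nth f0 (s ki.1) ki.2 else f0.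
exists h; split=> [n|x y hxy f Cf].
  rewrite /h; case: (choice.unpickle n : option (nat * nat)) => [[k i]|] //=.
  have [ik|ki] := ltnP i (size (s k)); first exact/sC/mem_nth.
  by rewrite nth_default.
apply: contrapT => fxy.
have [|k Ek] := @level_cover (x, y); first by exists f.
have [g gs] := sE k _ Ek; apply => /=.
have := hxy (choice.pickle (k, index g (s k))).
by rewrite /h choice.pickleK /= nth_index.
Qed.

End SeparatingSequence.

(** * The orbit-name factor *)

Lemma IPrigidP_compact (R : realType) (X : topologicalType) (T : X -> X)
    (U : set X) p (f : X -> R) :
  compact [set: X] -> continuous f -> U !=set0 ->
  IPrigid_on T U p f <->
  forall e : R, 0 < e -> exists N : nat, forall alpha, FinN alpha ->
    (forall i, i \in alpha -> (N < i)%N) ->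
    forall x, U x -> `|f (iter (psum p alpha) T x) - f x| <= e.
Proof. by move=> cX cf U0; apply: IPrigidP => //; exact: continuous_compact_bounded. Qed.

Lemma neq_constants_nonconstant (R : realType) (X : topologicalType) (C : set (X -> R)) :
  [set: X] !=set0 -> constants R X `<=` C -> C <> constants R X ->
  exists2 f, C f & nonconstant f.
Proof.
move=> [x0 _] sC nC; apply: contrapT => H; apply: nC.
apply/seteqP; split=> // f Cf; exists (f x0) => //.
apply/funext => x; apply: contrapT => fx; apply: H; exists f => //.
by exists x0, x.
Qed.

Lemma nonconstant_neq_constants (R : realType) (X : Type) (C : set (X -> R)) f :
  C f -> nonconstant f -> C <> constants R X.
Proof. by move=> Cf [x [y fxy]] CE; move: Cf fxy; rewrite CE => -[c _ <-]. Qed.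

Lemma constants_invcore (R : realType) (X : topologicalType) (T : selfbij X)
    (U : set X) p : compact [set: X] -> U !=set0 ->
  constants R X `<=` invcore R T U p.
Proof.
move=> cX U0 _ [c _ <-]; split; first exact: cst_continuous.
move=> j; split; first exact: cst_continuous.
apply/IPrigidP_compact => //; first exact: cst_continuous.
by move=> e e0; exists 0%N => a _ _ x _ /=; rewrite subrr normr0 ltW.
Qed.

Section NameFactor.
Context (R : realType) (X : topologicalType) (T : selfbij X) (f : X -> R).
Hypotheses (tdsT : is_tds R T) (cf : continuous f).

Let cX : compact [set: X]. Proof. by case: tdsT. Qed.
Let cT : continuous T. Proof. by case: tdsT. Qed.
Let cT' : continuous (sb_inv T). Proof. by case: tdsT. Qed.

Lemma orbit_name_continuous : continuous (orbit_name T f).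
Proof.
apply: ptws_continuous => j x; apply: continuous_comp; last exact: cf.
exact: zpow_continuous.
Qed.

Lemma name_map_continuous : continuous (name_map T f).
Proof. by apply: continuous_set_type; exact: orbit_name_continuous. Qed.

Lemma name_map_surj : range (name_map T f) = [set: name_space T f].
Proof.
apply/seteqP; split=> // y _; have [x _ xy] := set_valP y.
by exists x => //; exact: val_inj.
Qed.

Lemma name_map_shift x : name_map T f (T x) = name_shift T f (name_map T f x).
Proof. by apply/val_inj; rewrite /= shift_orbit_name. Qed.

Lemma name_coord_continuous (j : int) :
  continuous (fun y : name_space T f => (val y : int -> R) j).
Proof.
move=> y.
apply: (@continuous_comp (name_space T f) {ptws int -> R} R val (fun z => z j) y).
  exact: set_val_continuous.
exact: ptws_coord_continuous.
Qed.

Lemma name_shift_tds : is_tds R (name_shift T f).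
Proof.
have cr := compact_range cX orbit_name_continuous.
have [x _] : [set: X] !=set0 by case: tdsT.
split; first by exists (name_map T f x).
- exact: compact_set_type.
- exact: coords_metrizable.
- by apply: continuous_set_type; apply: ptws_continuous => j; exact: name_coord_continuous.
- by apply: continuous_set_type; apply: ptws_continuous => j; exact: name_coord_continuous.
Qed.

Lemma name_factor : factor_map T (name_shift T f) (name_map T f).
Proof.
split; [exact: name_map_continuous|exact: name_map_surj|exact: name_map_shift].
Qed.

End NameFactor.

(** Finitely many translates of the image of a closed ball in $U$ cover the
    factor, so one of them, hence the image itself, has interior. *)
Lemma minimal_factor_semiopen (R : realType) (X Y : topologicalType)
    (T : selfbij X) (S : selfbij Y) (q : X -> Y) (U : set X) :
  is_tds R T -> minimal_sys T -> is_tds R S -> factor_map T S q ->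
  open U -> U !=set0 ->
  exists W, [/\ open W, W !=set0 & W `<=` q @` U].
Proof.
move=> [X0 cX [d md] cT cT'] mT [Y0 cY [dY mdY] cS cS'] [cq qT qTS] oU [u Uu].
have [e e0 eU] := nbhs_cmetricP md (open_nbhs_nbhs (conj oU Uu)).
pose B := [set y | d u y <= e / 2]; pose V := B°.
have BU : B `<=` U by move=> y uy; apply: eU; rewrite /B /= in uy *; lra.
have V0 : V !=set0.
  exists u; apply: (@filterS _ _ _ [set y | d u y < e / 2]).
    by move=> y /ltW.
  by apply: (nbhs_cmetric_ball md); rewrite divr_gt0.
have [N HN] := minimal_return cX cT mT (@open_interior _ B) V0.
have qB : closed (q @` B).
  apply: compact_closed; first exact: cmetric_hausdorff mdY.
  apply: continuous_compact; first exact: continuous_subspaceT.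
  apply: (subclosed_compact _ cX) => //.
  apply: (@preimage_closed _ _ (d u) [set r | r <= e / 2]).
    by move=> y _; exact: cmetric_continuousr.
  exact: closed_le.
have [||||n _ [W [oW [w Ww] WE]]] :=
    @finite_closed_cover_interior _ (fun n => iter n S @^-1` (q @` B)) N setT.
- move=> n; apply: preimage_closed => // y _; exact: iter_continuous.
- exact: openT.
- by [].
- move=> y _; have [x _ <-] : range q y by rewrite qT.
  have [j jN Vj] := HN x; exists j => //; exists (iter j T x).
    exact: interior_subset Vj.
  exact: factor_iter.
have SnK : cancel (iter n S) (zpow S (- n%:Z)) by exact: (zpowK S n%:Z).
have SnK' : cancel (zpow S (- n%:Z)) (iter n S) by exact: (zpowNK S n%:Z).
exists (zpow S (- n%:Z) @^-1` W); split.
- by move/continuousP: (@zpow_continuous _ S (- n%:Z) cS cS'); apply.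
- by exists (iter n S w); rewrite /= SnK.
- move=> y /WE /=; rewrite SnK' => -[b Bb <-]; exists b => //; exact: BU.
Qed.

Section LocalFactor.
Context (R : realType) (X : topologicalType) (T : selfbij X).
Hypotheses (tdsT : is_tds R T) (minT : minimal_sys T).

Lemma rigid_name_factor (f : X -> R) (U : set X) (p : nat -> nat) :
  continuous f -> nonconstant f -> open U -> U !=set0 -> locIP R T U p f ->
  [/\ is_tds R (name_shift T f),
      factor_map T (name_shift T f) (name_map T f),
      nontrivial (name_space T f),
      nonconstant (name_coord0 T f)
    & exists W : set (name_space T f), [/\ open W, W !=set0
        & IPrigid_on (name_shift T f) W p (name_coord0 T f)]].
Proof.
move=> cf [x [y fxy]] oU U0 [_ rf].
have [_ cX _ _ _] := tdsT.
have tdsS := name_shift_tds tdsT cf; have fac := name_factor tdsT cf.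
have coord0 z : name_coord0 T f (name_map T f z) = f z by [].
split=> //.
- exists (name_map T f x), (name_map T f y) => xy.
  by apply: fxy; rewrite -!coord0 xy.
- by exists (name_map T f x), (name_map T f y).
have [W [oW W0 WU]] := minimal_factor_semiopen tdsT minT tdsS fac oU U0.
exists W; split=> //.
have [_ cY _ _ _] := tdsS; have [_ _ qTS] := fac.
apply/IPrigidP_compact => //.
  exact: name_coord_continuous.
move=> e e0; have /IPrigidP_compact /(_ e e0) [//|//|//|N HN] := rf.
exists N => a Fa Na _ /WU [z Uz <-].
by rewrite -(factor_iter qTS) !coord0; exact: HN.
Qed.

End LocalFactor.

(** * The invariant core and uniformly rigid factors *)

Section InvariantCore.
Context (R : realType) (X : topologicalType) (T : selfbij X).
Context (U : set X) (p : nat -> nat).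
Hypotheses (tdsT : is_tds R T) (minT : minimal_sys T).
Hypotheses (oU : open U) (U0 : U !=set0) (pp : posseq p).

Let cX : compact [set: X]. Proof. by case: tdsT. Qed.
Let cT : continuous T. Proof. by case: tdsT. Qed.
Let cT' : continuous (sb_inv T). Proof. by case: tdsT. Qed.

Lemma invcore_zpow i f : invcore R T U p f -> invcore R T U p (f \o zpow T i).
Proof.
move=> [cf Hf]; split.
  by move=> x; apply: continuous_comp; [exact: zpow_continuous|exact: cf].
move=> j; have -> : (f \o zpow T i) \o zpow T j = f \o zpow T (i + j); last exact: Hf.
by apply/funext => x /=; rewrite zpowD.
Qed.

Lemma invcore_bound f j e : invcore R T U p f -> 0 < e ->
  exists N : nat, forall a, FinN a -> (forall i, i \in a -> (N < i)%N) ->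
    forall x, U x ->
    `|f (zpow T j (iter (psum p a) T x)) - f (zpow T j x)| <= e.
Proof. by move=> [_ /(_ j) [cfj /IPrigidP_compact H]] e0; exact: H. Qed.

(** Finitely many translates $T^jU$ cover the minimal space, and on each of them
    $f$ behaves as $f\circ T^j$ does on $U$. *)
Lemma invcore_rigid f e : invcore R T U p f -> 0 < e ->
  exists N : nat, forall a, FinN a -> (forall i, i \in a -> (N < i)%N) ->
    forall x, `|f (iter (psum p a) T x) - f x| <= e.
Proof.
move=> Cf e0; have [M HM] := minimal_cover cX cT minT oU U0.
have [||N HN] := @finite_uniform_bound (fun j N => forall a, FinN a ->
  (forall i, i \in a -> (N < i)%N) -> forall x, U x ->
  `|f (zpow T j%:Z (iter (psum p a) T x)) - f (zpow T j%:Z x)| <= e) M.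
- by move=> n; exact: invcore_bound.
- move=> n N N' NN' H a Fa Na; apply: H => // i /Na; exact: leq_ltn_trans.
exists N => a Fa Na x; have [j [u [jM Uu ->]]] := HM x.
have := HN j jM a Fa Na u Uu; rewrite -[iter (psum _ _) _ _]/(zpow T (psum p a) _).
by rewrite /= -!iterD addnC.
Qed.

(** Uniform continuity on $Y$ reduces the estimate for $g\circ q$ to the
    estimates for finitely many of the core functions $h_n$. *)
Lemma invcore_pullback (Y : topologicalType) (q : X -> Y) (c : nat -> Y -> R)
    (h : nat -> X -> R) :
  compact [set: Y] -> continuous q -> (forall n, continuous (c n)) ->
  (forall y z, (forall n, c n y = c n z) -> y = z) ->
  (forall n x, h n x = c n (q x)) -> (forall n, invcore R T U p (h n)) ->
  pullback R q `<=` invcore R T U p.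
Proof.
move=> cY cq cc sep hc Ch _ [g cg <-].
have cgq : continuous (g \o q).
  by move=> x; apply: continuous_comp; [exact: cq|exact: cg].
split=> // j.
have cgqj : continuous ((g \o q) \o zpow T j).
  by move=> x; apply: continuous_comp; [exact: zpow_continuous|exact: cgq].
split=> //; apply/IPrigidP_compact => // e e0.
have [|||M HM] := @uniform_by_coords R Y c (fun w => g w.1 - g w.2) e cY cc sep.
- exact: difference_continuous.
- by move=> y; rewrite subrr.
- by [].
have [||N HN] := @finite_uniform_bound (fun n N => forall a, FinN a ->
  (forall i, i \in a -> (N < i)%N) -> forall x, U x ->
  `|h n (zpow T j (iter (psum p a) T x)) - h n (zpow T j x)| <= M.+1%:R^-1) M.
- by move=> n; apply: invcore_bound => //; rewrite invr_gt0 ltr0n.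
- move=> n N N' NN' H a Fa Na; apply: H => // i /Na; exact: leq_ltn_trans.
exists N => a Fa Na x Ux; apply/ltW/HM => n nM.
by rewrite -!hc; exact: HN.
Qed.

(** A pullback algebra is invariant, since
    $g\circ q'\circ T^j=(g\circ S'^j)\circ q'$. *)
Lemma invcore_maximal (Z : topologicalType) (S' : selfbij Z) (q' : X -> Z) :
  factor_map T S' q' -> is_tds R S' -> pullback R q' `<=` locIP R T U p ->
  pullback R q' `<=` invcore R T U p.
Proof.
move=> [cq' _ q'T] [_ _ _ cS cS'] sub _ [g cg <-].
split=> [x|j]; first by apply: continuous_comp; [exact: cq'|exact: cg].
apply: sub; exists (g \o zpow S' j).
  by move=> z; apply: continuous_comp; [exact: zpow_continuous|exact: cg].
by apply/funext => x /=; rewrite (factor_zpow q'T).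
Qed.

(** The universal property holds because a factor is determined by the point
    pairs it identifies, and $q'$ separates only pairs separated by the functions
    $d_Z(q'(x),q'(\cdot))$, which belong to the core. *)
Lemma core_factor : exists (Y : topologicalType) (S : selfbij Y) (q : X -> Y),
  [/\ is_tds R S, factor_map T S q, pullback R q = invcore R T U p,
      forall (Z : topologicalType) (S' : selfbij Z) (q' : X -> Z),
        is_tds R S' -> factor_map T S' q' ->
        pullback R q' `<=` locIP R T U p ->
        exists2 theta : Y -> Z, factor_map S S' theta & q' = theta \o q
    & uniformly_rigid R S].
Proof.
have [X0 _ [dX mdX] _ _] := tdsT.
have C0 : invcore R T U p !=set0.
  by exists (fun=> 0); apply: (@constants_invcore R X T U p cX U0); exists 0.
have cC f : invcore R T U p f -> continuous f by case.
have [h [Ch sepC]] := countable_separating_subfamily cX mdX C0 cC.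
have ch n : continuous (h n) by exact: cC.
have [|Y [S [q [c [tdsS fac cc sep hc]]]]] := @coordinate_factor R X T h tdsT ch.
  by move=> x y xy n; split;
    [exact: (sepC x y xy _ (invcore_zpow 1 (Ch n)))
    |exact: (sepC x y xy _ (invcore_zpow (- 1) (Ch n)))].
have [cq qT qTS] := fac; have [_ cY [dY mdY] cS cS'] := tdsS.
have hY := cmetric_hausdorff mdY.
have qsep x y f : q x = q y -> invcore R T U p f -> f x = f y.
  by move=> qxy; apply: sepC => n; rewrite !hc qxy.
have qsurj (y : Y) : {x | q x = y}.
  by apply: cid; have [x _ xy] : range q y by [rewrite qT]; exists x.
pose s y := sval (qsurj y).
have sK y : q (s y) = y by rewrite /s; case: (qsurj y).
exists Y, S, q; split=> //.
- apply/seteqP; split; first exact: (invcore_pullback cY cq cc sep hc Ch).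
  move=> f Cf; have fE : f = (f \o s) \o q.
    by apply/funext => x /=; apply: qsep => //; rewrite sK.
  exists (f \o s) => //.
  by apply: (continuous_descends cX hY cq qT); rewrite -fE; exact: cC.
- move=> Z S' q' tdsS' fac' sub; have [cq' q'T q'TS] := fac'.
  have [_ _ [dZ mdZ] _ _] := tdsS'.
  have q'E x y : q x = q y -> q' x = q' y.
    move=> qxy; apply: (cmetric_eq0 mdZ).
    have /(qsep x y _ qxy) /= <- : invcore R T U p (dZ (q' x) \o q').
      apply: (invcore_maximal fac' tdsS' sub); exists (dZ (q' x)) => //.
      exact: cmetric_continuousr.
    exact: cmetric_refl.
  have thq : q' = (q' \o s) \o q.
    by apply/funext => x /=; apply: q'E; rewrite sK.
  exists (q' \o s) => //; split.
  + by apply: (continuous_descends cX hY cq qT); rewrite -thq.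
  + apply/seteqP; split=> // z _; have [x _ xz] : range q' z by rewrite q'T.
    by exists (q x) => //; rewrite -xz [in RHS]thq.
  + by move=> y; rewrite -{1}(sK y) -qTS -q'TS -[LHS]/(((q' \o s) \o q) _) -thq.
- (* the times are chosen from the coordinates alone, so that they serve all
     compatible metrics at once *)
  have [|r [rm r0 rP]] := @increasing_choice (fun k r =>
    forall n, (n <= k)%N -> forall x, `|h n (iter r T x) - h n x| <= k.+1%:R^-1).
    move=> k m.
    have [||N HN] := @finite_uniform_bound (fun n N => forall a, FinN a ->
      (forall i, i \in a -> (N < i)%N) ->
      forall x, `|h n (iter (psum p a) T x) - h n x| <= k.+1%:R^-1) k.
    + by move=> n; apply: invcore_rigid => //; rewrite invr_gt0 ltr0n.
    + move=> n N N' NN' H a Fa Na; apply: H => // i /Na; exact: leq_ltn_trans.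
    have [a [Fa Na ma]] := exists_FinN_psum_gt N m pp.
    by exists (psum p a) => // n nk; exact: HN.
  exists r; split=> // d md; apply/cvgrPdist_le => e e0.
  have [|||M HM] := @uniform_by_coords R Y c (fun w => d w.1 w.2) e cY cc sep.
  + exact: cmetric_continuous.
  + by move=> y /=; exact: cmetric_refl.
  + by [].
  exists M => // k /= Mk; have [x0 _] := X0.
  have ub y : d (iter (r k) S y) y <= e.
    apply: le_trans (ler_norm _) _; apply/ltW/HM => n nM /=.
    rewrite -{1 2}(sK y) -(factor_iter qTS) -!hc.
    apply: (le_trans (rP k n (leq_trans nM Mk) _)).
    by rewrite lef_pV2 ?posrE ?ltr0n // ler_nat ltnS.
  rewrite sub0r normrN ger0_norm.
    apply: ge_sup; first by exists (d (iter (r k) S (q x0)) (q x0)), (q x0).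
    by move=> _ [y _ <-].
  apply: le_trans (cmetric_ge0 md (iter (r k) S (q x0)) (q x0)) _.
  by apply: ub_le_sup; [exists e => _ [y _ <-]|exists (q x0)].
Qed.

End InvariantCore.

(** Along $p_i=r_{k_i}$ with $\sup_y d(S^{p_i}y,y)\le 2^{-i}$ the triangle
    inequality gives $d(S^{p_\alpha}y,y)\le\sum_{i\in\alpha}2^{-i}$, which tends
    to $0$ as $\min\alpha\to\infty$; then all pulled back functions are rigid on
    the whole of $X$. *)
Lemma rigid_factor_invcore (R : realType) (X Y : topologicalType)
    (T : selfbij X) (S : selfbij Y) (q : X -> Y) :
  is_tds R T -> is_tds R S -> factor_map T S q -> nontrivial Y ->
  uniformly_rigid R S ->
  exists (U : set X) (p : nat -> nat),
    [/\ open U, U !=set0, posseq p & invcore R T U p <> constants R X].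
Proof.
move=> tdsT tdsS fac [y0 [y1 y01]] [r [rm r0 rS]].
have [X0 cX _ cT cT'] := tdsT; have [_ cY [d md] cS cS'] := tdsS.
have [cq qT qTS] := fac.
have bd k : has_ubound (range (fun y => d (iter (r k) S y) y)).
  have cYY : compact [set: (Y * Y)%type] by rewrite -setXTT; exact: compact_setX.
  have [M HM] := continuous_compact_bounded cYY (cmetric_continuous md).
  exists M => _ [y _ <-]; apply: le_trans (ler_norm _) _.
  exact: (HM (iter (r k) S y, y)).
have fast i : exists k, forall y, d (iter (r k) S y) y <= 2^-1 ^+ i.
  have i0 : 0 < 2^-1 ^+ i :> R by rewrite exprn_gt0 // invr_gt0.
  have /cvgrPdist_le /(_ _ i0) [K _ /(_ K (leqnn K)) /= HK] := rS d md.
  exists K => y; move: HK; rewrite sub0r normrN; apply: le_trans.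
  by apply: le_trans (ler_norm _); apply: ub_le_sup => //; exists y.
have [k Hk] := choice fast; pose p i := r (k i).
have pp : posseq p by move=> i _; exact: r0.
(* the right-hand side is the sum of $2^{-i}$ over $N<i\le N+K$ *)
have tail K N a : (forall i, i \in a -> (N < i <= N + K)%N) ->
    forall y, d (iter (psum p a) S y) y <= 2^-1 ^+ N - 2^-1 ^+ (N + K).
  elim: K a => [|K IH] a aN y.
    have -> : a = fset0.
      apply/fsetP => i; rewrite inE; apply/negP => /aN; rewrite addn0 => /andP[Ni iN].
      by rewrite ltnNge iN in Ni.
    by rewrite /psum big_nil /= (cmetric_refl md) addn0 subrr.
  have IH' : forall y, d (iter (psum p (a `\ (N + K).+1)%fset) S y) y
      <= 2^-1 ^+ N - 2^-1 ^+ (N + K).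
    apply: IH => i; rewrite !inE => /andP[iNK /aN /andP[-> /=]].
    by rewrite addnS leq_eqVlt (negbTE iNK).
  have half : 2^-1 ^+ (N + K) = 2 * 2^-1 ^+ (N + K).+1 :> R.
    by rewrite exprS mulrA divff // mul1r.
  have [Ka|Ka] := boolP ((N + K).+1 \in a); last first.
    have e0 : 0 <= 2^-1 ^+ (N + K).+1 :> R by rewrite exprn_ge0 // invr_ge0.
    have aE : (a `\ (N + K).+1)%fset = a.
      by apply/fsetP => i; rewrite !inE; case: eqP => // ->; rewrite (negbTE Ka).
    have := IH' y; rewrite aE addnS half; lra.
  rewrite (psum_fsetD1 _ Ka) iterD addnS.
  have := cmetric_triangle md (iter (p (N + K).+1) S
    (iter (psum p (a `\ (N + K).+1)%fset) S y))
    (iter (psum p (a `\ (N + K).+1)%fset) S y) y.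
  have := Hk (N + K).+1 (iter (psum p (a `\ (N + K).+1)%fset) S y).
  by have := IH' y; rewrite /p half; lra.
have rigid e : 0 < e -> exists N : nat, forall a, FinN a ->
    (forall i, i \in a -> (N < i)%N) ->
    forall y, d (iter (psum p a) S y) y < e.
  move=> e0.
  have : 2^-1 ^+ n @[n --> \oo] --> (0 : R).
    by apply: cvg_expr; rewrite ger0_norm ?invr_ge0 // invf_lt1 // ltr1n.
  move=> /cvgrPdist_lt /(_ _ e0) [N _ /(_ N (leqnn N)) /= HN].
  exists N => a Fa Na y; move: HN; rewrite sub0r normrN; apply: le_lt_trans.
  apply: le_trans (ler_norm _).
  have [K HK] : exists K, forall i, i \in a -> (i <= N + K)%N.
    exists (\max_(i <- a) i)%N => i ia; apply: leq_trans (leq_addl _ _).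
    exact: leq_bigmax_seq.
  apply: le_trans (tail K N a _ y) _.
    by move=> i ia; rewrite Na // HK.
  by rewrite gerBl exprn_ge0 // invr_ge0.
have inC : pullback R q `<=` invcore R T setT p.
  apply: (invcore_maximal fac tdsS) => _ [g cg <-].
  have cgq : continuous (g \o q).
    by move=> x; apply: continuous_comp; [exact: cq|exact: cg].
  split=> //; apply/IPrigidP_compact => //.
  move=> e e0.
  have [|||||M HM] := @uniform_control R Y (fun _ w => d w.1 w.2)
    (fun w => g w.1 - g w.2) e cY.
  - by move=> _; exact: cmetric_continuous.
  - by move=> y z /(_ 0%N); exact: cmetric_eq0.
  - exact: difference_continuous.
  - by move=> y; rewrite subrr.
  - by [].
  have [|N HN] := rigid M.+1%:R^-1; first by rewrite invr_gt0 ltr0n.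
  exists N => a Fa Na x _; apply/ltW/HM => n _ /=.
  by rewrite (factor_iter qTS) ger0_norm ?(cmetric_ge0 md) // ltW // HN.
exists setT, p; split=> //; first exact: openT.
have [x0 _ qx0] : range q y0 by rewrite qT.
have [x1 _ qx1] : range q y1 by rewrite qT.
apply: (@nonconstant_neq_constants _ _ _ (d y0 \o q)).
  by apply: inC; exists (d y0) => //; exact: cmetric_continuousr.
exists x0, x1 => /=; rewrite qx0 qx1 (cmetric_refl md) => d01.
exact/y01/(cmetric_eq0 md).
Qed.

(** * Transitive systems from lacunary sets of finite sums *)

Section OrbitClosure.
Context (R : realType) (omega : int -> R) (r : nat -> nat).
Hypotheses (omega01 : forall j, 0 <= omega j <= 1) (rL : forall L, (L < r L)%N).
Hypothesis recurrent :
  forall (L : nat) (j : int), `|j|%R <= L%:Z -> omega (j + (r L)%:Z) = omega j.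

Let sh (m : int) : {ptws int -> R} := fun j => omega (j + m).
Let A := closure (range sh).
Let Y : topologicalType := set_type A.

Let A_compact : compact A.
Proof.
pose K : set {ptws int -> R} := [set y | forall j, `[0, 1]%classic (y j)].
have cK : compact K.
  by apply: (@tychonoff int (fun=> R) (fun=> `[0, 1]%classic)) => _;
    exact: segment_compact.
have hK : hausdorff_space {ptws int -> R}.
  by apply: (@hausdorff_product int (fun=> R)) => _; exact: Rhausdorff.
apply: (subclosed_compact _ cK); first exact: closed_closure.
have /closure_id -> := compact_closed hK cK.
apply: closure_subset => _ [m _ <-] j.
by rewrite /= in_itv /= /sh omega01.
Qed.

Let zshiftA g : continuous g -> (forall m, range sh (g (sh m))) ->
  forall y : Y, g (val y) \in A.
Proof.
move=> cg gsh y; apply/mem_set => B /cg gB.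
have [_ [[m _ <-] Bm]] := set_valP y _ gB.
by exists (g (sh m)); split.
Qed.

Let zshift_continuous : continuous (@zshift R).
Proof. by apply: ptws_continuous => j; exact: ptws_coord_continuous. Qed.

Let zunshift_continuous : continuous (@zunshift R).
Proof. by apply: ptws_continuous => j; exact: ptws_coord_continuous. Qed.

Let zshift_sh m : zshift (sh m) = sh (m + 1).
Proof. by apply/funext => j; rewrite /zshift /sh addrAC addrA. Qed.

Let zunshift_sh m : zunshift (sh m) = sh (m - 1).
Proof. by apply/funext => j; rewrite /zunshift /sh addrAC addrA. Qed.

(** Recurrence lets every orbit point be approached at arbitrarily late times of
    the same orbit, so a dense two-sided orbit gives transitivity with positive
    transit times. *)
Lemma recurrent_orbit_closure : exists (Y : topologicalType) (S : selfbij Y)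
    (c : int -> Y -> R) (y : int -> Y),
  [/\ is_tds R S, transitive_sys S,
      (forall j, continuous (c j)) /\ (forall j z, c j (S z) = c (j + 1) z),
      forall m j, c j (y m) = omega (j + m) & dense (range y)].
Proof.
have sA1 : forall z : Y, zshift (val z) \in A.
  by apply: zshiftA => // m; exists (m + 1).
have sA2 : forall z : Y, zunshift (val z) \in A.
  by apply: zshiftA => // m; exists (m - 1).
pose S0 (z : Y) : Y := exist _ (zshift (val z)) (sA1 z).
pose S1 (z : Y) : Y := exist _ (zunshift (val z)) (sA2 z).
have SK : cancel S0 S1.
  by move=> z; apply/val_inj/funext => j; rewrite /= /zunshift /zshift subrK.
have SK' : cancel S1 S0.
  by move=> z; apply/val_inj/funext => j; rewrite /= /zunshift /zshift addrK.
pose S := Selfbij SK SK'.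
pose y (m : int) : Y := exist _ (sh m) (mem_set (subset_closure (imageT sh m))).
have Sy n m : iter n S (y m) = y (m + n%:Z).
  elim: n => [|n IH]; first by rewrite addr0.
  rewrite iterS IH; apply/val_inj; rewrite /= zshift_sh.
  by rewrite -addrA -(addn1 n) PoszD.
have dy : dense (range y).
  move=> B [z Bz] oB; move: oB Bz => [D oD <-]; rewrite set_valE => Dz.
  have [_ [[m _ <-] Dm]] := set_valP z D (open_nbhs_nbhs (conj oD Dz)).
  by exists (y m); split=> //; exists m.
exists Y, S, (fun j z => (val z : int -> R) j), y; split=> //.
- split; first by exists (y 0).
  + exact: compact_set_type.
  + exact: coords_metrizable.
  + apply: continuous_set_type => z.
    apply: (@continuous_comp Y {ptws int -> R} {ptws int -> R} val (@zshift R) z).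
      exact: set_val_continuous.
    exact: zshift_continuous.
  + apply: continuous_set_type => z.
    apply: (@continuous_comp Y {ptws int -> R} {ptws int -> R} val (@zunshift R) z).
      exact: set_val_continuous.
    exact: zunshift_continuous.
- move=> B D oB B0 oD D0.
  have [z1 [Ba [a _ az]]] := dy B B0 oB; rewrite -{z1}az in Ba.
  have [z2 [Db [b _ bz]]] := dy D D0 oD; rewrite -{z2}bz in Db.
  have cvb : y (b + (r k)%:Z) @[k --> \oo] --> y b.
    apply: cvg_set_type; apply: ptws_cvg => j.
    apply: cvg_near_cst; exists (absz (j + b)) => // k /= jk.
    by rewrite /sh addrA recurrent // -abszE lez_nat.
  have [K _ HK] := cvb _ (open_nbhs_nbhs (conj oD Db)).
  pose k := (K + absz (a - b)%R)%N.
  have k0 : 0 < b + (r k)%:Z - a.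
    have : (absz (a - b)%R <= k)%N by rewrite leq_addl.
    have := rL k; lia.
  exists (absz (b + (r k)%:Z - a)%R); first by rewrite absz_gt0 gt_eqF.
  exists (y a); split=> //=; rewrite Sy gtz0_abs // addrC subrK.
  by apply: HK; rewrite /= leq_addr.
- split=> // j z.
  apply: (@continuous_comp Y {ptws int -> R} R val (fun z => z j) z).
    exact: set_val_continuous.
  exact: ptws_coord_continuous.
Qed.

End OrbitClosure.

Lemma psum_fsetU p (a b : {fset nat}) : (forall i, i \in a -> i \notin b) ->
  psum p (a `|` b)%fset = (psum p a + psum p b)%N.
Proof.
move=> ab; rewrite /psum -big_cat; apply: perm_big; apply: uniq_perm.
- exact: fset_uniq.
- rewrite cat_uniq !fset_uniq andbT /=; apply/hasPn => i ib.
  by apply/negP => /ab; rewrite ib.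
- by move=> i; rewrite mem_cat inE.
Qed.

Section LacunarySums.
Context (q M : nat -> nat).
Hypotheses (M0 : M 0%N = 0%N) (MS : forall k, M k.+1 = (M k + q k)%N).
Hypothesis lac : forall k, (M k + k < q k)%N.

Lemma psum_bound k (a : {fset nat}) :
  (forall i, i \in a -> (i < k)%N) -> (psum q a <= M k)%N.
Proof.
elim: k a => [|k IH] a ak.
  have -> : a = fset0 by apply/fsetP => i; rewrite inE; apply/negP => /ak.
  by rewrite /psum big_nil.
have ak' i : i \in (a `\ k)%fset -> (i < k)%N.
  by rewrite !inE => /andP[ik /ak]; rewrite ltnS leq_eqVlt (negbTE ik).
rewrite MS; have [ka|ka] := boolP (k \in a).
  by rewrite (psum_fsetD1 _ ka) addnC leq_add2r IH.
apply: leq_trans (leq_addr _ _); apply: IH => i ia; apply: ak'.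
by rewrite !inE ia andbT; apply: contraNneq ka => <-.
Qed.

Lemma lacunary_mono i k : (k <= i)%N -> (q k <= q i)%N.
Proof.
move=> /subnKC <-; elim: (i - k)%N => [|n IH]; first by rewrite addn0.
by rewrite addnS; have := lac (k + n).+1; rewrite MS; lia.
Qed.

(** A single term $q_i$ with $i\ge k$ already exceeds the sum. *)
Lemma psum_lt_support k (a : {fset nat}) i :
  (psum q a < q k)%N -> i \in a -> (i < k)%N.
Proof.
move=> ak ia; rewrite ltnNge; apply/negP => /lacunary_mono.
by move: ak; rewrite (psum_fsetD1 _ ia); lia.
Qed.

Definition finite_sum (j : int) := exists a : {fset nat}, j = (psum q a)%:Z.

(** The gaps of a lacunary sequence make its set of finite sums recurrent:
    near $q_k$ it looks as it does near $0$. *)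
Lemma finite_sum_recurrent k (j : int) :
  `|j|%R <= k%:Z -> finite_sum (j + (q k)%:Z) <-> finite_sum j.
Proof.
move=> jk; split=> [[a ja]|[a ja]]; last first.
  exists (k |` a)%fset; rewrite psum_fsetU1 ?PoszD ?ja 1?addrC //.
  apply/negP => ka; have := psum_fsetD1 q ka; have := lac k; lia.
have ak i : i \in a -> (i < k.+1)%N.
  by apply: psum_lt_support; have := lac k.+1; rewrite MS; lia.
have ak' i : i \in (a `\ k)%fset -> (i < k)%N.
  by rewrite !inE => /andP[ik /ak]; rewrite ltnS leq_eqVlt (negbTE ik).
exists (a `\ k)%fset; have [ka|ka] := boolP (k \in a).
  by have := psum_fsetD1 q ka; lia.
have : (psum q a <= M k)%N.
  apply: psum_bound => i ia; apply: ak'.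
  by rewrite !inE ia andbT; apply: contraNneq ka => <-.
have := lac k; lia.
Qed.

End LacunarySums.

(** The terms of $q$ are sums of $p$ over consecutive blocks of indices, each
    taken long enough for the required gap; unions of blocks turn finite sums of
    $q$ into finite sums of $p$. *)
Lemma lacunary_subsystem (p : nat -> nat) N : posseq p ->
  exists q M : nat -> nat,
    [/\ M 0%N = 0%N, forall k, M k.+1 = (M k + q k)%N,
        forall k, (M k + k < q k)%N
      & forall a : {fset nat}, exists b : {fset nat},
          (forall i, i \in b -> (N < i)%N) /\ psum p b = psum q a].
Proof.
move=> pp.
pose block n m : {fset nat} := sval (cid (exists_FinN_psum_gt n m pp)).
have blockP n m : [/\ FinN (block n m), forall i, i \in block n m -> (n < i)%N
    & (m < psum p (block n m))%N] by rewrite /block; case: cid.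
(* the last index used so far and the sum of the blocks chosen so far *)
pose st := fix st k : nat * nat := if k is k'.+1 then
  let B := block (st k').1 ((st k').2 + k')%N in
  ((\max_(i <- B) i)%N, ((st k').2 + psum p B)%N) else (N, 0%N).
pose B k := block (st k).1 ((st k).2 + k)%N.
pose q k := psum p (B k).
have stS k : st k.+1 = ((\max_(i <- B k) i)%N, ((st k).2 + q k)%N) by [].
have maxB k i : i \in B k -> (i <= (st k.+1).1)%N.
  by move=> iB; rewrite stS /=; exact: leq_bigmax_seq.
have Bmin k i : i \in B k -> ((st k).1 < i)%N.
  by have [_ + _] := blockP (st k).1 ((st k).2 + k)%N; exact.
have stmono k : ((st k).1 <= (st k.+1).1)%N.
  have [[/fset0Pn [i iB] _] _ _] := blockP (st k).1 ((st k).2 + k)%N.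
  exact: leq_trans (ltnW (Bmin k i iB)) (maxB k i iB).
exists q, (fun k => (st k).2); split=> //.
  by move=> k; have [_ _] := blockP (st k).1 ((st k).2 + k)%N.
move=> a.
have main k : forall a : {fset nat}, (forall i, i \in a -> (i < k)%N) ->
    exists b : {fset nat},
      (forall i, i \in b -> (N < i <= (st k).1)%N) /\ psum p b = psum q a.
  elim: k => [|k IH] {}a ak.
    have -> : a = fset0 by apply/fsetP => i; rewrite inE; apply/negP => /ak.
    by exists fset0; split=> //; rewrite /psum !big_nil.
  have ak' i : i \in (a `\ k)%fset -> (i < k)%N.
    by rewrite !inE => /andP[ik /ak]; rewrite ltnS leq_eqVlt (negbTE ik).
  have [b [bN bE]] := IH _ ak'.
  have [ka|ka] := boolP (k \in a); last first.
    exists b; split=> [i /bN /andP[-> ib]|].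
      exact: leq_trans ib (stmono k).
    rewrite bE; congr psum; apply/fsetP => i; rewrite !inE.
    by case: eqP => // ->; rewrite (negbTE ka).
  have Nk : (N <= (st k).1)%N.
    by elim: (k) => // k' IHk; exact: leq_trans IHk (stmono k').
  exists (b `|` B k)%fset; split=> [i|].
    rewrite inE => /orP[/bN /andP[-> ib]|iB]; first exact: leq_trans ib (stmono k).
    by rewrite (leq_ltn_trans Nk (Bmin _ _ iB)) maxB.
  rewrite (psum_fsetD1 _ ka) -bE addnC psum_fsetU // => i /bN /andP[_ ib].
  by apply/negP => /Bmin; rewrite ltnNge ib.
have [|b [bN bE]] := main (\max_(i <- a) i).+1 a.
  by move=> i ia; rewrite ltnS; exact: leq_bigmax_seq.
by exists b; split=> // i /bN /andP[].
Qed.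

(** * Mild mixing and local rigidity *)

Lemma prod_map_iter (X Y : Type) (T : X -> X) (S : Y -> Y) n w :
  iter n (prod_map T S) w = (iter n T w.1, iter n S w.2).
Proof. by elim: n => [|n IH]; [case: w|rewrite iterS IH]. Qed.

Lemma dense_closed_all (Y : topologicalType) (D G : set Y) :
  dense D -> closed G -> D `<=` G -> forall y, G y.
Proof.
move=> dD cG DG y; apply: contrapT => nGy.
have [|z [nGz /DG]] := dD (~` G) _ (closed_openC cG); first by exists y.
exact: nGz.
Qed.

Section NoReturn.
Context (R : realType) (X : topologicalType) (T : selfbij X).
Hypotheses (tdsT : is_tds R T) (minT : minimal_sys T).

(** Let $U$ never enter $V$ at the finite sums of $p$.  Pass to a lacunary
    subsystem and let $y$ be the indicator of its finite sums, with orbit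
    closure $Y$.  The relation saying that $x$ avoids $V$ at all times marked by
    $z\in Y$ is closed and invariant; it holds on $T^mU\times\{S^my\}$ for every
    $m$, so finitely many of its translates in the first variable cover
    $X\times Y$ and it has interior.  Were $X\times Y$ transitive, it would be
    everything, which fails at points of $V\times\{y\}$. *)
Lemma no_return_not_mildly_mixing (U V : set X) (p : nat -> nat) (N : nat) :
  open U -> U !=set0 -> open V -> V !=set0 -> posseq p ->
  (forall a : {fset nat}, (forall i, i \in a -> (N < i)%N) ->
     forall x, U x -> ~ V (iter (psum p a) T x)) ->
  ~ mildly_mixing R T.
Proof.
move=> oU U0 oV [v Vv] pp avoid mm.
have [_ cX _ cT cT'] := tdsT.
have [q [M [M0 MS lac qp]]] := lacunary_subsystem N pp.
pose omega (j : int) : R := `[< finite_sum q j >]%:R.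
have [|||Y [S [c [y [tdsS trS [cc cS] cy dy]]]]] :=
    @recurrent_orbit_closure R omega q.
- by move=> j; rewrite /omega; case: asbool; rewrite lexx ler01.
- by move=> L; apply: leq_ltn_trans (lac L); rewrite leq_addl.
- move=> L j jL; rewrite /omega; congr (_%:R); congr nat_of_bool.
  exact/asbool_equiv_eq/(finite_sum_recurrent M0 MS lac).
have tr := mm Y S tdsS trS.
(* $c_j(z)\le 1/2$ says that time $j$ is unmarked in $z$, in a form that is
   visibly closed in $z$ *)
pose Rel := [set w : X * Y | forall j, c j w.2 <= 2^-1 \/ ~ V (zpow T j w.1)].
have cRel : closed Rel.
  have -> : Rel = \bigcap_j ([set w | c j w.2 <= 2^-1] `|`
      [set w | ~ V (zpow T j w.1)]).
    by apply/seteqP; split=> w H j; [move=> _; exact: H|exact: (H j I)].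
  apply: closed_bigI => j _; apply: closedU.
    apply: (@preimage_closed _ _ (fun w : X * Y => c j w.2) [set r | r <= 2^-1]).
      move=> w _; apply: (@continuous_comp (X * Y)%type Y R snd (c j) w).
        exact: cvg_snd.
      exact: cc.
    exact: closed_le.
  apply: (@preimage_closed _ _ (fun w : X * Y => zpow T j w.1) (~` V)).
    move=> w _; apply: (@continuous_comp (X * Y)%type X X fst (zpow T j) w).
      exact: cvg_fst.
    exact: zpow_continuous.
  exact: open_closedC.
pose mv i (w : X * Y) : X * Y := (zpow T i w.1, w.2).
have cmv i : continuous (mv i).
  move=> w; apply: cvg_pair; last exact: cvg_snd.
  apply: (@continuous_comp (X * Y)%type X X fst (zpow T i) w).
    exact: cvg_fst.
  exact: zpow_continuous.
have mvK i : cancel (mv i) (mv (- i)) by case=> x z; rewrite /mv zpowK.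
have mvNK i : cancel (mv (- i)) (mv i) by case=> x z; rewrite /mv zpowNK.
pose E (i : nat) := mv (- i%:Z) @^-1` Rel.
have cE i : closed (E i).
  by apply: preimage_closed => // w _; exact: cmv.
have [K HK] := minimal_cover cX cT minT oU U0.
have cover w : exists2 i, (i <= K)%N & E i w.
  case: w => x z.
  pose G := \bigcup_(i in `I_K.+1) ((fun z => (x, z)) @^-1` E i).
  have [||i /= iK Ei] := @dense_closed_all Y (range y) G dy _ _ z.
  - apply: closed_bigcup; first exact: finite_II.
    move=> i _; apply: preimage_closed => // t _.
    by apply: cvg_pair; [exact: cvg_cst|exact: cvg_id].
  - move=> _ [m _ <-]; have [i [u [iK Uu xE]]] := HK (zpow T (- m) x).
    exists i => //= j; rewrite cy /omega.
    case: asboolP => [[a ja]|_]; last by left; rewrite invr_ge0.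
    right; have [b [bN bE]] := qp a.
    rewrite /mv /=; have -> : zpow T (- i%:Z) x = zpow T m u.
      rewrite -(zpowNK T m x) xE -[iter i T u]/(zpow T i%:Z u) -!zpowD.
      by rewrite addrAC addNr add0r.
    by rewrite -zpowD ja -bE; exact: avoid.
  - by exists i.
have [||i _ [W [oW [w Ww] WE]]] :=
    @finite_closed_cover_interior _ E K setT cE (@openT _).
- by exists (v, y 0).
- by move=> w _; exact: cover.
have oO : open (mv i%:Z @^-1` W) by move/continuousP: (cmv i%:Z); apply.
have O0 : (mv i%:Z @^-1` W) !=set0.
  by exists (mv (- i%:Z) w); change (W (mv i%:Z (mv (- i%:Z) w))); rewrite mvNK.
have ORel : mv i%:Z @^-1` W `<=` Rel.
  move=> w' /WE; change (Rel (mv (- i%:Z) (mv i%:Z w')) -> Rel w').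
  by rewrite mvK.
have [|n _ [w1 [/ORel Rw1 /= nR]]] := tr _ (~` Rel) oO O0 (closed_openC cRel).
  exists (v, y 0) => /(_ 0) [|]; last by apply.
  rewrite cy addr0 /omega asboolT; last by exists fset0; rewrite /psum big_nil.
  by rewrite leNgt invf_lt1 // ltr1n.
apply: nR; elim: n => //= n IH j.
by rewrite cS -zpowS; exact: IH.
Qed.

(** Points of $U$ where $f$ is close to $f(u)$ are carried by $T^{p_\alpha}$ to
    points where $f$ is still close to $f(u)$, hence away from the region where
    $f$ is close to some $f(v)\ne f(u)$. *)
Lemma rigid_not_mildly_mixing (U : set X) (p : nat -> nat) (f : X -> R) :
  open U -> U !=set0 -> posseq p -> locIP R T U p f -> nonconstant f ->
  ~ mildly_mixing R T.
Proof.
move=> oU [u Uu] pp [cf rf] [x [y fxy]].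
have [_ cX _ _ _] := tdsT.
have [v fuv] : exists v, f u <> f v.
  have [fux|] := pselect (f u = f x); last by exists x.
  by exists y; rewrite fux.
(* three errors of size $e$ must not bridge the gap between $f(u)$ and $f(v)$ *)
pose e := `|f u - f v| / 4.
have e0 : 0 < e by rewrite divr_gt0 // normr_gt0 subr_eq0; apply/eqP.
have ob w : open [set z | `|f z - f w| < e].
  have /continuousP cw : continuous (fun z => `|f z - f w|).
    by move=> z; apply: cvg_norm; apply: cvgB; [exact: cf|exact: cvg_cst].
  exact: (cw [set r | r < e] (@open_lt R e)).
have U0 : U !=set0 by exists u.
have /IPrigidP_compact /(_ e e0) [//|//|//|N HN] := rf.
have oU1 := openI oU (ob u).
refine (@no_return_not_mildly_mixing (U `&` [set z | `|f z - f u| < e])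
  [set z | `|f z - f v| < e] p N _ _ _ _ pp _) => //.
- by exists u; split=> //=; rewrite subrr normr0.
- by exists v => /=; rewrite subrr normr0.
move=> a Na z [Uz /= zu] /= zv.
have zz : `|f (iter (psum p a) T z) - f z| <= e.
  have [->|a0] := eqVneq a fset0.
    by rewrite /psum big_nil /= subrr normr0 ltW.
  by apply: HN => //; split=> // i /Na; exact: leq_ltn_trans.
have := ler_distD (f (iter (psum p a) T z)) (f u) (f v).
have := ler_distD (f z) (f u) (f (iter (psum p a) T z)).
rewrite (distrC (f u) (f z)) (distrC (f z) (f (iter _ _ _))).
have : `|f u - f v| = 4 * e by rewrite /e; lra.
lra.
Qed.

End NoReturn.

Section FiniteSumReturns.
Context (Y : topologicalType) (S : Y -> Y) (V : set Y).
Hypotheses (cS : continuous S) (tS : transitive_sys S).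
Hypotheses (oV : open V) (V0 : V !=set0).

(** Put $V_0=V$ and $V_{k+1}=V_k\cap S^{-p_k}V_k$, where $p_k$ is a return time
    of $V_k$.  A point of a late $V_k$ then returns to $V$ at all sums of
    distinct earlier $p_i$. *)
Lemma transitive_finite_sum_returns : exists2 p : nat -> nat,
  (forall i, (0 < p i)%N) &
  forall a : {fset nat}, exists2 y, V y & V (iter (psum p a) S y).
Proof.
pose state := {B : set Y | open B /\ B !=set0}.
have ret (B : state) : {n | (0 < n)%N & sval B `&` (iter n S @^-1` sval B) !=set0}.
  by apply: cid2; case: B => B [oB B0]; exact: tS.
pose step (B : state) : state := exist _ _
  (conj (openI (svalP B).1 (open_comp (fun x _ => @iter_continuous _ S _ cS x) (svalP B).1))
        (s2valP' (ret B))).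
pose st k := iter k step (exist _ V (conj oV V0) : state).
pose p k := s2val (ret (st k)).
have stS k : sval (st k.+1) = sval (st k) `&` (iter (p k) S @^-1` sval (st k)) by [].
have stV k : sval (st k) `<=` V.
  by elim: k => [|k IH] // z; rewrite stS => -[/IH].
exists p; first by move=> i; exact: (s2valP (ret (st i))).
move=> a.
have main k : forall a : {fset nat}, (forall i, i \in a -> (i < k)%N) ->
    forall z, sval (st k) z -> V (iter (psum p a) S z).
  elim: k => [|k IH] {}a ak z.
    have -> : a = fset0 by apply/fsetP => i; rewrite inE; apply/negP => /ak.
    by rewrite /psum big_nil.
  rewrite stS => -[zk zpk].
  have ak' i : i \in (a `\ k)%fset -> (i < k)%N.
    by rewrite !inE => /andP[ik /ak]; rewrite ltnS leq_eqVlt (negbTE ik).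
  have [ka|ka] := boolP (k \in a).
    by rewrite (psum_fsetD1 _ ka) addnC iterD; exact: IH.
  by apply: IH => // i ia; apply: ak'; rewrite !inE ia andbT; apply: contraNneq ka => <-.
have [z zk] := (svalP (st (\max_(i <- a) i).+1)).2.
exists z; first exact: stV zk.
by apply: main zk => i ia; rewrite ltnS; exact: leq_bigmax_seq.
Qed.

End FiniteSumReturns.

Lemma open_setX (X Y : topologicalType) (B : set (X * Y)) : open B ->
  B !=set0 -> exists (U : set X) (V : set Y),
    [/\ open U, U !=set0, open V, V !=set0 & U `*` V `<=` B].
Proof.
move=> oB [[x y] Bxy].
have [[P Q] /= [Px Qy] PQ] : nbhs (x, y) B by exact: open_nbhs_nbhs.
exists P°, Q°; split; [exact: open_interior|by exists x|exact: open_interior|by exists y|].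
by move=> [a b] [/= Pa Qb]; apply: PQ; split; exact: interior_subset.
Qed.

(** Let boxes $U_1\times V_1$ and $U_2\times V_2$ never meet, and let $m$ be a
    transit time from $V_1$ to $V_2$.  If $V_1\cap S^{-m}V_2$ returns at time
    $n$, then $V_1$ reaches $V_2$ at time $m+n$, so $U_1$ misses $T^{-m}U_2$ at
    time $n$; by [transitive_finite_sum_returns] this happens at all finite sums
    of some $p$.  Testing on $T^{p_1}U_1$ instead of $U_1$ places the starting
    points outside $T^{-m}U_2$ as well. *)
Lemma not_mildly_mixing_rigid (R : realType) (X : topologicalType)
    (T : selfbij X) : is_tds R T -> ~ mildly_mixing R T ->
  exists (U : set X) (p : nat -> nat) (f : X -> R),
    [/\ open U, U !=set0, posseq p, locIP R T U p f & nonconstant f].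
Proof.
move=> [X0 cX [d md] cT cT'] nmm.
have [Y [S [tdsS trS ntr]]] : exists (Y : topologicalType) (S : selfbij Y),
    [/\ is_tds R S, transitive_sys S &
      ~ transitive_sys (prod_map T S : (X * Y)%type -> _)].
  apply: contrapT => H; apply: nmm => Y S tdsS trS; apply: contrapT => ntr.
  by apply: H; exists Y, S.
have [_ _ _ cS _] := tdsS.
have [A [B [oA A0 oB B0 AB]]] : exists A B : set (X * Y),
    [/\ open A, A !=set0, open B, B !=set0 & forall n, (0 < n)%N ->
      forall w, A w -> ~ B (iter n (prod_map T S) w)].
  apply: contrapT => H; apply: ntr => A B oA A0 oB B0; apply: contrapT => nn.
  apply: H; exists A, B; split=> // n n0 w Aw Bw; apply: nn; exists n => //.
  by exists w.
have [U1 [V1 [oU1 [u0 Uu0] oV1 V10 UVA]]] := open_setX oA A0.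
have [U2 [V2 [oU2 [w0 Uw0] oV2 V20 UVB]]] := open_setX oB B0.
have [m m0 V30] := trS V1 V2 oV1 V10 oV2 V20.
have oV3 : open (V1 `&` (iter m S @^-1` V2)).
  by apply: openI => //; move/continuousP: (@iter_continuous _ S m cS); apply.
have [p p0 ret] := transitive_finite_sum_returns cS trS oV3 V30.
have avoid a x : U1 x -> ~ U2 (iter m T (iter (psum p a) T x)).
  move=> Ux U2x; have [y [V1y _] [_ V2y]] := ret a.
  apply: (AB (m + psum p a)%N _ (x, y)); first by rewrite addn_gt0 m0.
    exact: UVA.
  by rewrite prod_map_iter; apply: UVB; split; rewrite /= iterD.
pose V := iter m T @^-1` U2.
have oV : open V by move/continuousP: (@iter_continuous _ T m cT); apply.
pose v := zpow T (- m%:Z) w0.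
have Vv : V v by rewrite /V /v /= -[iter m T _]/(zpow T m%:Z _) zpowNK.
have [e e0 eV] := nbhs_cmetricP md (open_nbhs_nbhs (conj oV Vv)).
pose f x := Num.max 0 (e - d v x).
have f0 x : ~ V x -> f x = 0.
  move=> nVx; apply/max_idPl; rewrite subr_le0 leNgt; apply/negP => vx.
  exact: nVx (eV x vx).
have cf : continuous f.
  have -> : f = (fun=> 0) \max (fun x => e - d v x) by [].
  move=> x; apply: continuous_max; first exact: cvg_cst.
  by apply: cvgB; [exact: cvg_cst|exact: cmetric_continuousr].
pose U := zpow T (- (p 1%N)%:Z) @^-1` U1.
have UE x : U x -> exists2 u, U1 u & x = iter (p 1%N) T u.
  move=> Ux; exists (zpow T (- (p 1%N)%:Z) x) => //.
  by rewrite -[RHS]/(zpow T (p 1%N)%:Z _) zpowNK.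
have oU : open U.
  by move/continuousP: (@zpow_continuous _ T (- (p 1%N)%:Z) cT cT'); apply.
have Uu : U (iter (p 1%N) T u0).
  by rewrite /U /= -[iter _ _ _]/(zpow T (p 1%N)%:Z u0) zpowK.
have U0 : U !=set0 by exists (iter (p 1%N) T u0).
have psum1 : psum p [fset 1%N]%fset = p 1%N by rewrite /psum big_seq_fset1.
exists U, p, f; split=> //.
  split=> //; apply/IPrigidP_compact => // r r0.
  exists 1%N => a Fa a1 _ /UE [u Uu1 ->].
  rewrite f0; last first.
    rewrite -iterD addnC -psum_fsetU1; first exact: avoid.
    by apply/negP => /a1.
  by rewrite -psum1 f0 ?subrr ?normr0 ?ltW //; exact: avoid.
exists v, (iter (p 1%N) T u0).
rewrite [f (iter _ _ _)]f0; last by rewrite -psum1; exact: avoid.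
rewrite /f (cmetric_refl md) subr0; apply/eqP.
by rewrite (max_idPr (ltW e0)) gt_eqF.
Qed.

Theorem theorem4 (R : realType) (X : topologicalType) (T : selfbij X)
    (tdsT : is_tds R T) (minT : minimal_sys T) :
  [/\
    forall (f : X -> R) (U : set X) (p : nat -> nat),
      continuous f -> (forall x, 0 <= f x <= 1) -> nonconstant f ->
      open U -> U !=set0 -> posseq p -> locIP R T U p f ->
      [/\ is_tds R (name_shift T f),
          factor_map T (name_shift T f) (name_map T f),
          nontrivial (name_space T f),
          nonconstant (name_coord0 T f)
        & exists W : set (name_space T f), [/\ open W, W !=set0
            & IPrigid_on (name_shift T f) W p (name_coord0 T f)]],
    forall (U : set X) (p : nat -> nat), open U -> U !=set0 -> posseq p ->
      exists (Y : topologicalType) (S : selfbij Y) (q : X -> Y),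
        [/\ is_tds R S, factor_map T S q, pullback R q = invcore R T U p,
            forall (Z : topologicalType) (S' : selfbij Z) (q' : X -> Z),
              is_tds R S' -> factor_map T S' q' ->
              pullback R q' `<=` locIP R T U p ->
              exists2 theta : Y -> Z, factor_map S S' theta & q' = theta \o q
          & invcore R T U p <> constants R X -> uniformly_rigid R S],
    ~ mildly_mixing R T <->
      exists (U : set X) (p : nat -> nat),
        [/\ open U, U !=set0, posseq p & locIP R T U p <> constants R X]
  & (exists (Y : topologicalType) (S : selfbij Y) (q : X -> Y),
        [/\ is_tds R S, factor_map T S q, nontrivial Y & uniformly_rigid R S]) <->
      exists (U : set X) (p : nat -> nat),
        [/\ open U, U !=set0, posseq p & invcore R T U p <> constants R X]].
Proof.
have [X0 cX _ _ _] := tdsT.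
split.
- by move=> f U p cf _ nf oU U0 _; exact: rigid_name_factor.
- move=> U p oU U0 pp.
  have [Y [S [q [tdsS fac core max rig]]]] := core_factor tdsT minT oU U0 pp.
  by exists Y, S, q; split.
- split=> [nmm|[U [p [oU U0 pp nC]]]].
    have [U [p [f [oU U0 pp Lf nf]]]] := not_mildly_mixing_rigid tdsT nmm.
    by exists U, p; split=> //; exact: nonconstant_neq_constants Lf nf.
  have [|f Lf nf] := neq_constants_nonconstant X0 _ nC.
    by move=> f /(constants_invcore T p cX U0) [_ /(_ 0)].
  exact: rigid_not_mildly_mixing Lf nf.
- split=> [[Y [S [q [tdsS fac nY rig]]]]|[U [p [oU U0 pp nC]]]].
    exact: rigid_factor_invcore fac nY rig.
  have [Y [S [q [tdsS fac core _ rig]]]] := core_factor tdsT minT oU U0 pp.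
  exists Y, S, q; split=> //.
  have [|f Cf [x [y fxy]]] := neq_constants_nonconstant X0 _ nC.
    exact: constants_invcore.
  exists (q x), (q y) => qxy; move: Cf fxy; rewrite -core => -[g _ <-].
  by rewrite /= qxy.
Qed.
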